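(* Let $p(\cdot)\in\mathcal{P}(\mathbb{R}^d)$ and let $\alpha,q$ be constants with $p(\cdot)\le\alpha\le q\le\infty$. Then $\left(L^{p(\cdot)},\ell^{q}\right)^{\alpha}$ is the Köthe dual space of $\mathcal{H}(p'(\cdot),q',\alpha')$.
   Context: $L^0$ is the set of (a.e.-equivalence classes of) measurable complex-valued functions on $\mathbb{R}^d$. $\mathcal{P}(\mathbb{R}^d)$ is the set of measurable $p(\cdot):\mathbb{R}^d\to[1,\infty]$ with $1<p_-\le p(\cdot)\le p_+<\infty$, where $p_-$ and $p_+$ are the essential infimum and supremum. Conjugate exponents (variable or constant) are given by $\frac1{s'}=1-\frac1s$ with $\frac1\infty=0$. $\|f\|_{p(\cdot)}=\inf\{\lambda>0:\int_{\mathbb{R}^d}(|f(x)|/\lambda)^{p(x)}dx\le1\}$; $L^{p(\cdot)}$ is the set of measurable $f$ with $\|f\|_{p(\cdot)}<\infty$; $L^{p(\cdot)}_{\rm loc}$ is the set of measurable $f$ with $f\chi_K\in L^{p(\cdot)}$ for every compact $K$. For $k\in\mathbb{Z}^d$, $r>0$, $I_k^r=\prod_{j=1}^d[rk_j,r(k_j+1))$. $\|f\|_{p(\cdot),q}=\big\|\{\|f\chi_{I_k^1}\|_{p(\cdot)}\}_{k\in\mathbb{Z}^d}\big\|_{\ell^q}$ and $(L^{p(\cdot)},\ell^q)=\{f\in L^{p(\cdot)}_{\rm loc}:\|f\|_{p(\cdot),q}<\infty\}$. For $\rho>0$, $St_\rho^{(\alpha)}f(x)=\rho^{-d/\alpha}f(\rho^{-1}x)$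 (with $d/\infty=0$). For $p(\cdot)\le\alpha\le q\le\infty$, the Fofana space is $\left(L^{p(\cdot)},\ell^{q}\right)^{\alpha}=\{f\in L^{p(\cdot)}_{\rm loc}:\|f\|_{p(\cdot),q,\alpha}<\infty\}$ with norm $\|f\|_{p(\cdot),q,\alpha}=\sup_{\rho>0}\|St_\rho^{(\alpha)}f\|_{p(\cdot),q}$. For a variable exponent $r(\cdot)$ and constants $1\le s\le\beta\le r(\cdot)$, an $\mathfrak{h}$-decomposition of $f\in L^{r(\cdot)}_{\rm loc}$ is a sequence $\{(c_n,\rho_n,f_n)\}_{n\ge1}$ in $\mathbb{C}\times(0,\infty)\times(L^{r(\cdot)},\ell^s)$ with $\|f_n\|_{r(\cdot),s}\le1$ for all $n$, $\sum_{n\ge1}|c_n|<\infty$, and $f=\sum_{n\ge1}c_nSt_{\rho_n}^{(\beta)}f_n$ in the sense of $L^{r(\cdot)}_{\rm loc}$. $\mathcal{H}(r(\cdot),s,\beta)$ is the set of $f\in L^{r(\cdot)}_{\rm loc}$ having at least one $\mathfrak{h}$-decomposition. With $\sigma_{r(\cdot),s,\beta}(f)$ the infimum of $\sum_{n\ge1}|c_n|$ over all $\mathfrak{h}$-decompositions of $f$ ($\infty$ if there are none), its norm is $\|f\|_{\mathcal{H}(r(\cdot),s,\beta)}=\sigma_{r(\cdot),s,\beta}(|f|)$. $\mathcal{H}(p'(\cdot),q',\alpha')$ is this space with $r(\cdot)=p'(\cdot)$, $s=q'$, $\beta=\alpha'$. The Köthe dual $X'$ of a normed Köthe space $X$ is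 the set of $g\in L^0$ with $\|g\|_{X'}=\sup\{\int_{\mathbb{R}^d}|g(x)f(x)|dx: f\in X,\ \|f\|_X\le1\}<\infty$. *)

(* Defs.v *)
From HB Require Import structures.
From mathcomp Require Import all_boot all_order all_algebra.
From mathcomp Require Import all_classical all_reals all_analysis.
From mathcomp Require Import measurable_realfun ess_sup_inf complex.

Set Implicit Arguments.
Unset Strict Implicit.
Unset Printing Implicit Defensive.

Import Order.TTheory GRing.Theory Num.Theory.
Import numFieldNormedType.Exports.

Local Open Scope classical_set_scope.
Local Open Scope ring_scope.

(* R^n carries the product sigma-algebra generated by the coordinates, which
   is its Borel sigma-algebra.  Functions are not quotiented by a.e. equality:
   all the norms below only depend on a.e.-equivalence classes, so Borel and
   Lebesgue measurable functions give the same spaces. *)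
Definition measure_rV_display : measure_display. Proof. exact. Qed.

Section measurable_rV.
Variables (R : realType) (n : nat).

Definition rV_coord (i : 'I_n) (x : 'rV[R]_n) : measurableTypeR R := x ord0 i.

Let rV_set0 : g_sigma_preimage rV_coord set0.
Proof. exact: sigma_algebra0. Qed.

Let rV_setC A : g_sigma_preimage rV_coord A -> g_sigma_preimage rV_coord (~` A).
Proof. exact: sigma_algebraC. Qed.

Let rV_bigcup (F : (set 'rV[R]_n)^nat) :
  (forall i, g_sigma_preimage rV_coord (F i)) ->
  g_sigma_preimage rV_coord (\bigcup_i (F i)).
Proof. exact: sigma_algebra_bigcup. Qed.

HB.instance Definition _ := @isMeasurable.Build measure_rV_display
  'rV[R]_n (g_sigma_preimage rV_coord) rV_set0 rV_setC rV_bigcup.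

End measurable_rV.

Lemma measurable_rV_coord (R : realType) (n : nat) (i : 'I_n) :
  measurable_fun [set: 'rV[R]_n] (@rV_coord R n i).
Proof.
move=> _ Y mY; rewrite setTI; apply: sub_sigma_algebra => /=.
rewrite -bigcup_seq/=; exists i => /=; first by rewrite mem_index_enum.
by exists Y => //; rewrite setTI.
Qed.

Lemma measurable_fun_rVP d (T : measurableType d) (R : realType) (n : nat)
    (f : T -> 'rV[R]_n) :
  measurable_fun [set: T] f <->
  forall i, measurable_fun [set: T] (fun x => rV_coord i (f x)).
Proof.
split=> [mf i|mf].
  by apply: measurableT_comp => //; exact: measurable_rV_coord.
move=> _ A mA; rewrite setTI.
suff : g_sigma_preimage (@rV_coord R n) `<=` [set B | measurable (f @^-1` B)].
  by apply.
apply: smallest_sub.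
  split => /=.
  - by rewrite preimage_set0.
  - by move=> B mB; rewrite setTD -preimage_setC; exact: measurableC.
  - by move=> F mF; rewrite preimage_bigcup; exact: bigcup_measurable.
rewrite -bigcup_seq => B [i _ [Y mY <-]] /=; rewrite setTI.
by rewrite -[X in measurable X]setTI; exact: mf.
Qed.

Section lebesgue_rV_step.
Variables (R : realType) (n : nat).

Definition rV_cons (z : measurableTypeR R * 'rV[R]_n) : 'rV[R]_n.+1 :=
  \row_j oapp (z.2 ord0) z.1 (unlift ord0 j).

Definition rV_uncons (x : 'rV[R]_n.+1) : measurableTypeR R * 'rV[R]_n :=
  (x ord0 ord0, \row_j x ord0 (lift ord0 j)).

Lemma rV_consK : cancel rV_cons rV_uncons.
Proof.
move=> [a v]; rewrite /rV_uncons /rV_cons !mxE unlift_none/=; congr pair.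
by apply/rowP => j; rewrite !mxE liftK.
Qed.

Lemma measurable_rV_cons : measurable_fun [set: measurableTypeR R * 'rV[R]_n] rV_cons.
Proof.
apply/measurable_fun_rVP => i.
have [j ->|->] := unliftP ord0 i.
  rewrite (_ : (fun _ => _) = @rV_coord R n j \o snd).
    by apply: measurableT_comp => //; exact: measurable_rV_coord.
  by apply/funext => z; rewrite /rV_coord/= mxE liftK.
rewrite (_ : (fun _ => _) = fst) //.
by apply/funext => z; rewrite /rV_coord/= mxE unlift_none.
Qed.

Lemma measurable_rV_uncons : measurable_fun [set: 'rV[R]_n.+1] rV_uncons.
Proof.
apply/measurable_fun_pairP; split; first exact: (@measurable_rV_coord R n.+1 ord0).
apply/measurable_fun_rVP => i.
rewrite (_ : (fun _ => _) = @rV_coord R n.+1 (lift ord0 i)).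
  exact: measurable_rV_coord.
by apply/funext => z; rewrite /rV_coord/= mxE.
Qed.

Variable m : {sigma_finite_measure set 'rV[R]_n -> \bar R}.

Definition lebesgue_rV_step : set 'rV[R]_n.+1 -> \bar R :=
  pushforward (lebesgue_measure \x m)%E rV_cons.

Let step0 : lebesgue_rV_step set0 = 0%E.
Proof. by rewrite /lebesgue_rV_step /pushforward preimage_set0 measure0. Qed.

Let step_ge0 A : (0 <= lebesgue_rV_step A)%E.
Proof. exact: (measure_ge0 (lebesgue_measure \x m)%E). Qed.

Let step_sigma_additive : semi_sigma_additive lebesgue_rV_step.
Proof.
have mcons A : measurable A -> measurable (rV_cons @^-1` A).
  by move=> mA; rewrite -[X in measurable X]setTI; exact: measurable_rV_cons.
move=> F mF tF mUF; rewrite /lebesgue_rV_step /pushforward preimage_bigcup.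
apply: (measure_semi_sigma_additive (s := (lebesgue_measure \x m)%E)).
- by move=> k; exact: mcons.
- apply/trivIsetP => i j _ _ ij; rewrite -preimage_setI.
  by move/trivIsetP : tF => /(_ _ _ _ _ ij) ->//; rewrite preimage_set0.
- by rewrite -preimage_bigcup; exact: mcons.
Qed.

HB.instance Definition _ := isMeasure.Build _ _ _ lebesgue_rV_step
  step0 step_ge0 step_sigma_additive.

Let step_sigma_finite : sigma_finite setT lebesgue_rV_step.
Proof.
have /sigma_finiteP[F [TF ndF Foo]] := sigma_finiteT (@lebesgue_measure R).
have /sigma_finiteP[G [TG ndG Goo]] := sigma_finiteT m.
exists (fun k => rV_uncons @^-1` (F k `*` G k)).
  rewrite -preimage_bigcup -[LHS](preimage_setT rV_uncons); congr (_ @^-1` _).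
  rewrite -setXTT TF TG predeqE => -[x y]; split.
    move=> [/= [k _ Fkx] [l _ Gly]]; exists (maxn k l) => //; split.
    - by move: x Fkx; exact/subsetPset/ndF/leq_maxl.
    - by move: y Gly; exact/subsetPset/ndG/leq_maxr.
  by move=> [k _ []/= ? ?]; split; exists k.
move=> k; have [mF Fk] := Foo k; have [mG Gk] := Goo k.
have mFG : measurable (F k `*` G k) by exact: measurableX.
split; first by rewrite -[X in measurable X]setTI; exact: measurable_rV_uncons.
rewrite /lebesgue_rV_step /pushforward -comp_preimage.
rewrite (_ : rV_uncons \o rV_cons = id); last by apply/funext; exact: rV_consK.
by rewrite preimage_id product_measure1E// lte_mul_pinfty// ge0_fin_numE.
Qed.

HB.instance Definition _ := Measure_isSigmaFinite.Build _ _ _ lebesgue_rV_step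
  step_sigma_finite.

End lebesgue_rV_step.

(* Lebesgue measure on R^n, the n-fold product of the Lebesgue measure of R. *)
Fixpoint lebesgue_rV (R : realType) (n : nat) :
    {sigma_finite_measure set 'rV[R]_n -> \bar R} :=
  match n with
  | 0 => dirac (0 : 'rV[R]_0)
  | n'.+1 => lebesgue_rV_step (lebesgue_rV R n')
  end.

Section spaces.
Variables (R : realType) (d : nat).

Local Notation mu := (lebesgue_rV R d).
Local Notation fct := ('rV[R]_d -> complex R).

Definition measurable_cfun (f : fct) : Prop :=
  measurable_fun setT (fun x => complex.Re (f x)) /\
  measurable_fun setT (fun x => complex.Im (f x)).

Definition cutoff (A : set 'rV[R]_d) (f : fct) : fct :=
  fun x => if x \in A then f x else 0.

(* The class P(R^d) of exponents; conjugate exponents (variable or constant)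
   are given by [hoelder_conjugate]. *)
Definition exponent_class (p : 'rV[R]_d -> \bar R) : Prop :=
  [/\ measurable_fun setT p, forall x, (1 <= p x)%E,
      (1 < ess_inf mu p)%E & (ess_sup mu p < +oo)%E].

(* t^r for t >= 0 and r in [1, +oo], with the usual convention that t^oo is 0
   for t <= 1 and +oo otherwise. *)
Definition pow_exponent (t : R) (r : \bar R) : \bar R :=
  match r with
  | r'%:E => (t `^ r')%:E
  | _ => if t <= 1 then 0%E else +oo%E
  end.

Definition Lp_norm (p : 'rV[R]_d -> \bar R) (f : fct) : \bar R :=
  ereal_inf [set l%:E | l in [set l : R | 0 < l /\
    (\int[mu]_x pow_exponent (Normc.normc (f x) / l) (p x) <= 1)%E]].

Definition Lp_loc (p : 'rV[R]_d -> \bar R) : set fct :=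
  [set f | measurable_cfun f /\
    forall K : set 'rV[R]_d, compact K -> (Lp_norm p (cutoff K f) < +oo)%E].

Definition cube (r : R) (k : 'rV[int]_d) : set 'rV[R]_d :=
  [set x | forall j, r * (k ord0 j)%:~R <= x ord0 j < r * (k ord0 j + 1)%:~R].

(* l^q norm of a nonnegative family indexed by Z^d, 1 <= q <= +oo *)
Definition lq_norm (q : \bar R) (a : 'rV[int]_d -> \bar R) : \bar R :=
  match q with
  | q'%:E => ((\esum_(k in setT) (a k `^ q')) `^ q'^-1)%E
  | _ => ereal_sup (range a)
  end.

Definition amalgam_norm (p : 'rV[R]_d -> \bar R) (q : \bar R) (f : fct) :
    \bar R :=
  lq_norm q (fun k => Lp_norm p (cutoff (cube 1 k) f)).

Definition amalgam (p : 'rV[R]_d -> \bar R) (q : \bar R) : set fct :=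
  [set f | Lp_loc p f /\ (amalgam_norm p q f < +oo)%E].

(* St_rho^(alpha); [fine alpha^-1] is 1 / alpha, and 0 for alpha = +oo *)
Definition dilation (alpha : \bar R) (rho : R) (f : fct) : fct :=
  fun x => (rho `^ (- (d%:R * fine (alpha^-1)%E)))%:C%C * f (rho^-1 *: x).

Definition fofana_norm (p : 'rV[R]_d -> \bar R) (q alpha : \bar R) (f : fct) :
    \bar R :=
  ereal_sup [set amalgam_norm p q (dilation alpha rho f) |
    rho in [set rho : R | 0 < rho]].

Definition fofana (p : 'rV[R]_d -> \bar R) (q alpha : \bar R) : set fct :=
  [set f | Lp_loc p f /\ (fofana_norm p q alpha f < +oo)%E].

(* Convergence in L^r_loc is convergence of [Lp_norm r] on every compact set. *)
Definition h_decomposition (r : 'rV[R]_d -> \bar R) (s beta : \bar R) (f : fct)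
    (c : nat -> complex R) (rho : nat -> R) (F : nat -> fct) : Prop :=
  [/\ forall n, 0 < rho n,
      forall n, amalgam r s (F n) /\ (amalgam_norm r s (F n) <= 1)%E,
      (\sum_(0 <= n <oo) (Normc.normc (c n))%:E < +oo)%E &
      forall K : set 'rV[R]_d, compact K ->
        Lp_norm r (cutoff K (fun x =>
          f x - \sum_(0 <= n < N) c n * dilation beta (rho n) (F n) x))
          @[N --> \oo] --> 0%E].

Definition H_space (r : 'rV[R]_d -> \bar R) (s beta : \bar R) : set fct :=
  [set f | Lp_loc r f /\ exists c rho F, h_decomposition r s beta f c rho F].

Definition H_sigma (r : 'rV[R]_d -> \bar R) (s beta : \bar R) (f : fct) :
    \bar R :=
  ereal_inf [set S | exists c rho F, h_decomposition r s beta f c rho F /\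
    S = (\sum_(0 <= n <oo) (Normc.normc (c n))%:E)%E].

Definition H_norm (r : 'rV[R]_d -> \bar R) (s beta : \bar R) (f : fct) :
    \bar R :=
  H_sigma r s beta (fun x => (Normc.normc (f x))%:C%C).

Definition kothe_dual_norm (X : set fct) (normX : fct -> \bar R) (g : fct) :
    \bar R :=
  ereal_sup [set (\int[mu]_x (Normc.normc (g x * f x))%:E)%E |
    f in [set f | X f /\ (normX f <= 1)%E]].

Definition kothe_dual (X : set fct) (normX : fct -> \bar R) : set fct :=
  [set g | measurable_cfun g /\ (kothe_dual_norm X normX g < +oo)%E].

End spaces.

(* Main.v *)
Require Import Defs.
From mathcomp Require Import all_boot all_order all_algebra.
From mathcomp Require Import all_classical all_reals all_analysis.
From mathcomp Require Import measurable_realfun ess_sup_inf complex.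
From mathcomp Require Import ring lra zify.

(** Write g for an element of the Fofana space, p' for the conjugate exponent,
    and q', alpha' for the conjugates of q and alpha.  Two facts make the two
    spaces dual to each other.

    The dilations are adjoint ([dilation_adjoint]): since 1/alpha + 1/alpha' = 1,
    a change of variables moves [dilation alpha' rho] from one factor of a
    pairing to [dilation alpha rho^-1] on the other factor.  And the amalgams
    (L^p, l^q) and (L^p', l^q') are dual to each other, up to a constant, cube by
    cube.

    Upper bound.  The amalgam Hoelder inequality ([amalgam_hoelder]) and the
    adjunction show that g pairs with every dilated atom of an h-decomposition by
    at most 4 times the Fofana norm of g.  Summing over the atoms bounds the
    pairing of g with |f|.  The series only converges in L^p'_loc, so this is
    done on a compact set, where the remainder tends to 0 by Hoelder's
    inequality because g is in L^p_loc ([h_decomposition_pairing_le]).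

    Lower bound.  A single dilated atom is an element of H of norm at most 1
    ([one_atom_decomposition]), so a function of finite dual norm M has all its
    dilations G bounded by M when tested against bounded, boundedly supported
    functions u >= 0 of amalgam norm at most 1 ([kothe_test]).  On each cube, a
    nearly optimal u for the norm of G is (G/lam)^(p-1), truncated and normalised
    ([Lp_norm_dual_witness]); gluing these with the coefficients that are
    extremal for l^q duality gives the amalgam norm of G
    ([tested_amalgam_norm]).  Taking the supremum over the dilations gives the
    Fofana norm, and testing on a box gives membership in L^p_loc.

    A dilation of a function in L^p_loc may leave L^p_loc, as the exponent is not
    dilated with it.  This is why the lower bound works with bounded, boundedly
    supported test functions: they lie in L^p'_loc, and so do their dilations. *)

Set Implicit Arguments.
Unset Strict Implicit.
Unset Printing Implicit Defensive.

Import Order.TTheory GRing.Theory Num.Theory.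
Import numFieldNormedType.Exports.

Local Open Scope classical_set_scope.
Local Open Scope ring_scope.

(** * Lebesgue measure on R^n: scaling, boxes *)

Section lebesgue_measure_on_rV.
Variable R : realType.
Local Open Scope ereal_scope.

(** Both sides of the substitution rule are integrals against measures that
    agree on intervals, hence on Borel sets. *)
Lemma ge0_integral_lebesgue_scale (r : R) (f : R -> \bar R) : (0 < r)%R ->
  measurable_fun [set: measurableTypeR R] f -> (forall x, 0 <= f x) ->
  \int[lebesgue_measure]_x f (r * x)%R = r^-1%:E * \int[lebesgue_measure]_x f x.
Proof.
move=> r0 mf f0.
pose phi : measurableTypeR R -> measurableTypeR R := *%R r.
have mr : measurable_fun setT phi.
  exact: mulrl_measurable.
(* named explicitly: the measure structure takes the measurability proof *)
pose push : {measure set (measurableTypeR R) -> \bar R} :=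
  measure_function_pushforward__canonical__measure_function_Measure
    lebesgue_measure mr.
pose nu : {measure set (measurableTypeR R) -> \bar R} :=
  mscale (NngNum (ltW r0)) push.
have nuE A : measurable A -> lebesgue_measure A = nu A.
  apply: lebesgue_measure_unique => _ [[a b] _ <-].
  rewrite [RHS](_ : _ = r%:E * lebesgue_measure (phi @^-1` `]a, b])) //=.
  rewrite (_ : _ @^-1` _ = `]r^-1 * a, r^-1 * b]%classic)%R; last first.
    apply/seteqP; split => x /=;
      by rewrite !in_itv/= ltr_pdivrMl// ler_pdivlMl.
  rewrite !lebesgue_measure_itv/= !lte_fin ltr_pM2l ?invr_gt0//.
  case: ifPn => _; last by rewrite mule0.
  by rewrite -!EFinD -EFinM -mulrBr mulrA divff ?gt_eqF// mul1r.
rewrite [in RHS](eq_measure_integral nu); last by move=> A mA _; exact: nuE.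
rewrite ge0_integral_mscale// ge0_integral_pushforward//.
by rewrite preimage_setT muleA -EFinM /= mulVf ?gt_eqF// mul1e.
Qed.

Lemma ge0_integral_lebesgue_rVS (n : nat) (f : 'rV[R]_n.+1 -> \bar R) :
  measurable_fun setT f -> (forall x, 0 <= f x) ->
  \int[lebesgue_rV R n.+1]_x f x =
  \int[lebesgue_measure]_a \int[lebesgue_rV R n]_v f (rV_cons (a, v)).
Proof.
move=> mf f0.
rewrite [LHS](ge0_integral_pushforward (@measurable_rV_cons R n)
  (lebesgue_measure \x lebesgue_rV R n))//.
rewrite preimage_setT fubini_tonelli1//=.
by apply: measurableT_comp => //; exact: measurable_rV_cons.
Qed.

Lemma measurable_rV_scale (n : nat) (r : R) :
  measurable_fun [set: 'rV[R]_n] ( *:%R r).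
Proof.
apply/measurable_fun_rVP => i.
rewrite (_ : (fun _ => _) = fun x => (r * rV_coord i x)%R); last first.
  by apply/funext => x; rewrite /rV_coord mxE.
exact: measurable_funM (measurable_cst _) (measurable_rV_coord i).
Qed.

(** Induction on the dimension: Tonelli's theorem splits off the first
    coordinate, where the one-dimensional substitution rule applies. *)
Lemma ge0_integral_rV_scale (n : nat) (r : R) (f : 'rV[R]_n -> \bar R) :
  (0 < r)%R -> measurable_fun setT f -> (forall x, 0 <= f x) ->
  \int[lebesgue_rV R n]_x f (r *: x)%R =
  (r^-1 ^+ n)%:E * \int[lebesgue_rV R n]_x f x.
Proof.
move=> r0; elim: n f => [|n IH] f mf f0.
  rewrite expr0 mul1e; apply: eq_integral => x _; congr f.
  by apply/rowP => -[].
rewrite ge0_integral_lebesgue_rVS//; last first.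
  by apply: measurableT_comp => //; exact: measurable_rV_scale.
have scale_cons (a : R) (v : 'rV[R]_n) :
    (r *: rV_cons (a, v))%R = rV_cons ((r * a)%R, (r *: v)%R).
  apply/rowP => i; rewrite !mxE/=.
  by case: (unlift ord0 i) => //= j; rewrite mxE.
have mfc : measurable_fun setT (f \o @rV_cons R n).
  by apply: measurableT_comp => //; exact: measurable_rV_cons.
have mfv (a : R) : measurable_fun setT (fun v => f (rV_cons (a, v))).
  exact: measurableT_comp mfc (measurable_pair1 a).
under eq_integral => a _ do under eq_integral => v _ do rewrite scale_cons.
under eq_integral => a _.
  rewrite (IH (fun v => f (rV_cons ((r * a)%R, v))))//.
  over.
have mF : measurable_fun [set: measurableTypeR R]
    (fun a => \int[lebesgue_rV R n]_v f (rV_cons (a, v))).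
  exact: (measurable_fun_fubini_tonelli_F (m2 := lebesgue_rV R n) _ mfc
    (fun=> f0 _)).
rewrite ge0_integralZl//; last 3 first.
- apply: (measurableT_comp mF); exact: mulrl_measurable.
- by move=> x _; exact: integral_ge0.
- by rewrite lee_fin exprn_ge0// invr_ge0 ltW.
rewrite (@ge0_integral_lebesgue_scale r
  (fun a => \int[lebesgue_rV R n]_v f (rV_cons (a, v))))//; last first.
  by move=> x; exact: integral_ge0.
by rewrite muleA -EFinM -exprSr -ge0_integral_lebesgue_rVS.
Qed.

Definition rV_box (n : nat) (a b : R) : set 'rV[R]_n :=
  [set x | forall j, (a <= x ord0 j < b)%R].

Lemma measurable_rV_forall (n : nat) (A : 'I_n -> set (measurableTypeR R)) :
  (forall j, measurable (A j)) ->
  measurable [set x : 'rV[R]_n | forall j, A j (x ord0 j)].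
Proof.
move=> mA.
rewrite (_ : mkset _ = \big[setI/setT]_(j < n) (@rV_coord R n j @^-1` A j)).
  apply: bigsetI_measurable => j _; rewrite -[X in measurable X]setTI.
  exact: measurable_rV_coord.
rewrite -bigcap_seq; apply/seteqP; split => [x Ax j _|x Ax j]; first exact: Ax.
by apply: (Ax j); rewrite /= mem_index_enum.
Qed.

Lemma measurable_rV_box (n : nat) (a b : R) : measurable (@rV_box n a b).
Proof.
apply: (@measurable_rV_forall n (fun=> `[a, b[%classic)) => j.
exact: measurable_itv.
Qed.

Lemma lebesgue_rV_box (n : nat) (a b : R) : (a <= b)%R ->
  lebesgue_rV R n (rV_box a b) = ((b - a) ^+ n)%:E.
Proof.
move=> ab; elim: n => [|n IH].
  rewrite expr0 /= diracE mem_set//; by case.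
rewrite /= /lebesgue_rV_step/= /pushforward.
rewrite (_ : _ @^-1` _ = `[a, b[%classic `*` rV_box a b); last first.
  apply/seteqP; split => [[x v] /= H|[x v] [/= Hx Hv] i].
    split => /=.
      by have := H ord0; rewrite mxE unlift_none/= in_itv.
    by move=> j; have := H (lift ord0 j); rewrite mxE liftK.
  rewrite mxE; have [j _|_] := unliftP ord0 i; first exact: Hv.
  by move: Hx; rewrite in_itv.
rewrite product_measure1E//; last exact: measurable_rV_box.
rewrite IH /=.
rewrite [X in X * _](lebesgue_measure_itv `[a, b[) /= lte_fin exprS EFinM.
case: ltP => // ba; have -> : b = a by apply/eqP; rewrite eq_le ba ab.
by rewrite subrr.
Qed.

End lebesgue_measure_on_rV.

(** * Variable exponent modulars and norms *)

Section variable_exponent_norm.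
Variables (R : realType) (d : nat).
Local Notation mu := (lebesgue_rV R d).
Local Notation fct := ('rV[R]_d -> complex R).
Local Notation normc := Normc.normc.
Implicit Types (p : 'rV[R]_d -> \bar R) (f g : fct) (u v : 'rV[R]_d -> R).

Lemma normc_ge0 (z : complex R) : 0 <= normc z.
Proof. by case: z => a b; exact: sqrtr_ge0. Qed.

Lemma normc_real (x : R) : normc (x%:C)%C = `|x|.
Proof. by rewrite /= expr0n addr0 sqrtr_sqr. Qed.

Lemma hoelder_conjugate_EFin (r : R) : 1 < r ->
  hoelder_conjugate r%:E = (r / (r - 1))%:E.
Proof.
move=> r1; rewrite /hoelder_conjugate/= eqe gt_eqF ?(lt_trans ltr01)//.
by rewrite -EFinB inver subr_eq0 gt_eqF.
Qed.

Lemma pow_exponent_ge0 (t : R) (r : \bar R) : (0 <= pow_exponent t r)%E.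
Proof.
by case: r => [r| |] /=; rewrite ?lee_fin ?powR_ge0//; case: ifP => // _; rewrite leey.
Qed.

Lemma le_pow_exponent (s t : R) (r : \bar R) : (1 <= r)%E -> 0 <= s -> s <= t ->
  (pow_exponent s r <= pow_exponent t r)%E.
Proof.
case: r => [r| |] //=; rewrite ?lee_fin => r1 s0 st.
  have r0 : 0 <= r by apply: le_trans r1.
  by apply: ge0_ler_powR => //; rewrite nnegrE (le_trans s0).
case: ifPn => s1; first by case: ifPn => _ //; rewrite leey.
by rewrite ifF//; apply/negbTE; apply: contra s1; exact: le_trans.
Qed.

Lemma pow_exponent_le_id (t : R) (r : \bar R) : (1 <= r)%E -> 0 <= t <= 1 ->
  (pow_exponent t r <= t%:E)%E.
Proof.
case: r => [r| |] //=; rewrite ?lee_fin => r1 /andP[t0 t1].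
  move: t0; rewrite le_eqVlt => /predU1P[<-|t0].
    by rewrite powR0// gt_eqF// (lt_le_trans ltr01).
  by apply: ge1r_powR => //; rewrite t0.
by rewrite t1.
Qed.

(** Young's inequality, with the factors 1/r and 1/r' dropped. The limit cases
    r = 1 and r = +oo hold because t^oo is 0 or +oo according to whether t <=
    1. *)
Lemma pow_exponent_young (s t : R) (r : \bar R) : (1 <= r)%E ->
  0 <= s -> 0 <= t ->
  ((s * t)%:E <= pow_exponent s r + pow_exponent t (hoelder_conjugate r))%E.
Proof.
move=> r1 s0 t0; case: r r1 => [r| |] //=; last first.
  move=> _; rewrite powRr1//; case: ifPn => s1.
    by rewrite add0e lee_fin ler_piMl.
  by rewrite addye// leey.
rewrite lee_fin le_eqVlt => /predU1P[<-|r1].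
  rewrite hoelder_conjugate1/= powRr1//; case: ifPn => t1.
    by rewrite adde0 lee_fin ler_piMr.
  by rewrite addey// leey.
rewrite hoelder_conjugate_EFin//= lee_fin.
have r0 : 0 < r by apply: lt_trans r1.
have r10 : 0 < r - 1 by rewrite subr_gt0.
have cr0 : 0 < r / (r - 1) by rewrite divr_gt0.
apply: le_trans (conjugate_powR s0 t0 r0 cr0 _) _.
  by rewrite invf_div mulrBl divff ?gt_eqF// mul1r addrC subrK.
by rewrite lerD// ler_pdivrMr// ler_peMr ?powR_ge0// ?(ltW r1)//
   ler_pdivlMr// mul1r gerBl.
Qed.

(** The real power is unfolded to its definition by exp and ln, and infinite
    exponents are treated apart. *)
Lemma measurable_pow_exponent p u : measurable_fun setT p ->
  measurable_fun setT u -> measurable_fun setT (fun x => pow_exponent (u x) (p x)).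
Proof.
move=> mp meas_u.
have mfine : measurable_fun setT (fun x => fine (p x)) by exact: measurableT_comp.
rewrite (_ : (fun _ => _) = fun x =>
    if p x \is a fin_num then
      (if u x == 0 then (if fine (p x) == 0 then 1 else 0)
       else expR (fine (p x) * ln (u x)))%:E
    else (if u x <= 1 then 0%E else +oo%E)); last first.
  apply/funext => x; case: (p x) => [r| |] //=.
  by rewrite /powR; case: ifP => // _; case: eqP.
apply: measurable_fun_ifT.
- apply: (measurable_fun_bool true).
  exact: (emeasurable_fin_num measurableT mp).
- apply/measurable_EFinP; apply: measurable_fun_ifT.
  + exact: measurable_fun_eqr.
  + by apply: measurable_fun_ifT => //; exact: measurable_fun_eqr.
  + apply: measurableT_comp => //; apply: measurable_funM => //.
    exact: measurableT_comp.
- apply: measurable_fun_ifT => //.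
  exact: measurable_fun_ler.
Qed.

Lemma measurable_hoelder_conjugate p : measurable_fun setT p ->
  (forall x, 1 <= p x)%E ->
  measurable_fun setT (fun x => hoelder_conjugate (p x)).
Proof.
move=> mp p1.
have mfine : measurable_fun setT (fun x => fine (p x)) by exact: measurableT_comp.
rewrite (_ : (fun _ => _) = fun x =>
    if p x \is a fin_num then
      (if fine (p x) == 1 then +oo%E
       else (fine (p x) * (fine (p x) - 1) `^ (-1))%:E)
    else 1%E); last first.
  apply/funext => x; case: (p x) (p1 x) => [r| |] //=.
  rewrite lee_fin le_eqVlt => /predU1P[<-|r1].
    by rewrite hoelder_conjugate1 eqxx.
  by rewrite hoelder_conjugate_EFin// gt_eqF// powR_inv1// subr_ge0 ltW.
apply: measurable_fun_ifT => //.
- apply: (measurable_fun_bool true).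
  exact: (emeasurable_fin_num measurableT mp).
- apply: measurable_fun_ifT => //; first exact: measurable_fun_eqr.
  apply/measurable_EFinP; apply: measurable_funM => //.
  apply: (measurableT_comp (measurable_powR _)).
  exact: measurable_funB.
Qed.

Lemma measurable_normc f : measurable_cfun f ->
  measurable_fun setT (fun x => normc (f x)).
Proof.
move=> [mre mim].
rewrite (_ : (fun _ => _) = fun x =>
    (complex.Re (f x) ^+ 2 + complex.Im (f x) ^+ 2) `^ 2^-1); last first.
  apply/funext => x; case: (f x) => a b /=.
  by rewrite powR12_sqrt// addr_ge0// sqr_ge0.
apply: (measurableT_comp (measurable_powR _)).
by apply: measurable_funD; apply: measurable_funX.
Qed.

Lemma measurable_normcM f g : measurable_cfun f -> measurable_cfun g ->
  measurable_fun setT (fun x => (normc (f x * g x))%:E).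
Proof.
move=> mf mg; apply/measurable_EFinP.
under eq_fun do rewrite Normc.normcM.
by apply: measurable_funM; exact: measurable_normc.
Qed.

Lemma measurable_cfun_real u : measurable_fun setT u ->
  measurable_cfun (fun x => (u x)%:C%C).
Proof. by move=> meas_u; split => //=; exact: measurable_cst. Qed.

Lemma measurable_cutoff (A : set 'rV[R]_d) f : measurable A ->
  measurable_cfun f -> measurable_cfun (cutoff A f).
Proof.
move=> mA [mre mim].
have mAb : measurable_fun setT (fun x => x \in A).
  apply: (measurable_fun_bool true); rewrite setTI.
  rewrite (_ : _ @^-1` _ = A)//; apply/seteqP; split => x /=; last exact: mem_set.
  exact: set_mem.
rewrite /measurable_cfun; split.
  rewrite (_ : (fun _ => _) = fun x => if x \in A then complex.Re (f x) else 0).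
    exact: measurable_fun_ifT.
  by apply/funext => x; rewrite /cutoff; case: ifP.
rewrite (_ : (fun _ => _) = fun x => if x \in A then complex.Im (f x) else 0).
  exact: measurable_fun_ifT.
by apply/funext => x; rewrite /cutoff; case: ifP.
Qed.

Lemma normc_cutoff (A : set 'rV[R]_d) f x :
  normc (cutoff A f x) = normc (f x) * \1_A x.
Proof.
by rewrite /cutoff indicE; case: ifP => _; rewrite ?mulr1// mulr0 Normc.normc0.
Qed.

(** The integral of a nonnegative function is a supremum over the simple
    functions below it, so monotonicity holds without measurability. This
    matters for cutoffs to compact sets. *)
Lemma ge0_integral_mono (F G : 'rV[R]_d -> \bar R) : (forall x, 0 <= F x)%E ->
  (forall x, F x <= G x)%E -> (\int[mu]_x F x <= \int[mu]_x G x)%E.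
Proof.
move=> F0 FG; have G0 x : (0 <= G x)%E by apply: le_trans (FG x).
rewrite !ge0_integralTE//; apply: le_ereal_sup => _ [h hF <-].
by exists h => // x; apply: le_trans (FG x).
Qed.

Definition modular p u : \bar R := (\int[mu]_x pow_exponent (u x) (p x))%E.

Lemma le_modular p u v : (forall x, 1 <= p x)%E ->
  (forall x, 0 <= u x <= v x) -> (modular p u <= modular p v)%E.
Proof.
move=> p1 uv; apply: ge0_integral_mono => x; first exact: pow_exponent_ge0.
by have /andP[? ?] := uv x; exact: le_pow_exponent.
Qed.

Lemma Lp_norm_ge0 p f : (0 <= Lp_norm p f)%E.
Proof. by apply: le_ereal_inf_tmp => _ [l [l0 _] <-]; rewrite lee_fin ltW. Qed.

Lemma le_Lp_norm p f g : (forall x, 1 <= p x)%E ->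
  (forall x, normc (f x) <= normc (g x)) -> (Lp_norm p f <= Lp_norm p g)%E.
Proof.
move=> p1 fg; apply: le_ereal_inf => _ [l [l0 lg] <-]; exists l => //; split => //.
apply: le_trans lg; apply: le_modular => // x.
by rewrite divr_ge0 ?normc_ge0 ?(ltW l0)//= ler_pM2r ?invr_gt0.
Qed.

(** The modular decreases in l, so the defining inequality holds at every l
    above the infimum. *)
Lemma Lp_norm_lt_modular p f (l : R) : (forall x, 1 <= p x)%E ->
  (Lp_norm p f < l%:E)%E -> 0 < l /\ (modular p (fun x => normc (f x) / l)%R <= 1)%E.
Proof.
move=> p1 /ereal_inf_lt[_ [k [k0 kf] <-]]; rewrite lte_fin => kl.
have l0 := lt_trans k0 kl; split => //.
apply: le_trans kf; apply: le_modular => // x.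
by rewrite divr_ge0 ?normc_ge0 ?(ltW l0)//= ler_wpM2l ?normc_ge0// lef_pV2 ?posrE// ltW.
Qed.

(** How norms are bounded throughout: domination by c times a function of
    modular at most 1. *)
Lemma Lp_norm_le_modular p f u (c : R) : (forall x, 1 <= p x)%E -> 0 <= c ->
  (modular p u <= 1)%E -> (forall x, 0 <= u x) -> (forall x, normc (f x) <= c * u x) ->
  (Lp_norm p f <= c%:E)%E.
Proof.
move=> p1 c0 u1 u0 fu; apply/lee_addgt0Pr => e e0.
have ce0 : 0 < c + e by rewrite ltr_wpDl.
apply: ereal_inf_lbound; exists (c + e) => //; split => //.
apply: le_trans u1; apply: le_modular => // x.
rewrite divr_ge0 ?normc_ge0 ?(ltW ce0)//= ler_pdivrMr// (le_trans (fu x))//.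
by rewrite mulrC ler_wpM2l// lerDl ltW.
Qed.

Lemma Lp_norm0 p f : (forall x, 1 <= p x)%E -> (forall x, f x = 0) -> Lp_norm p f = 0%E.
Proof.
move=> p1 f0; apply/eqP; rewrite eq_le Lp_norm_ge0 andbT.
apply: (@Lp_norm_le_modular _ _ (fun=> 0)) => //; last first.
  by move=> x; rewrite f0 Normc.normc0 mul0r.
apply: (@le_trans _ _ 0%E) => //; rewrite -(integral0 mu setT).
apply: ge0_integral_mono => x; first exact: pow_exponent_ge0.
by apply: pow_exponent_le_id => //; rewrite lexx ler01.
Qed.

(** For l large the quotient |f|/l is at most 1, where t^r <= t; its modular
    is then at most B |A| / l, whatever the exponent. *)
Lemma Lp_norm_bounded_lty p f (A : set 'rV[R]_d) (B : R) : (forall x, 1 <= p x)%E ->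
  measurable A -> (mu A < +oo)%E -> 0 <= B ->
  (forall x, normc (f x) <= B * \1_A x) -> (Lp_norm p f < +oo)%E.
Proof.
move=> p1 mA Afin B0 fB.
have mAE : mu A = (fine (mu A))%:E by rewrite fineK// ge0_fin_numE.
set m := fine (mu A) in mAE.
have m0 : 0 <= m by rewrite fine_ge0.
pose l := B + B * m + 1.
have Bm0 : 0 <= B * m by rewrite mulr_ge0.
have l0 : 0 < l by rewrite ltr_wpDl// addr_ge0.
suff : (Lp_norm p f <= l%:E)%E by move/le_lt_trans; apply; rewrite ltry.
apply: ereal_inf_lbound; exists l => //; split => //.
apply: (@le_trans _ _ (\int[mu]_x ((B / l) * \1_A x)%:E)%E).
  apply: ge0_integral_mono => x; first exact: pow_exponent_ge0.
  have f1 : normc (f x) / l <= B / l * \1_A x by rewrite mulrAC ler_pM2r ?invr_gt0.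
  apply: (@le_trans _ _ (normc (f x) / l)%:E); last by rewrite lee_fin.
  apply: pow_exponent_le_id => //; rewrite divr_ge0 ?normc_ge0 ?(ltW l0)//=.
  apply: le_trans f1 _; apply: (@le_trans _ _ (B / l)).
    by rewrite ler_piMr ?divr_ge0 ?(ltW l0)// indicE lern1 leq_b1.
  by rewrite ler_pdivrMr// mul1r /l -addrA lerDl addr_ge0.
under eq_integral do rewrite EFinM.
rewrite ge0_integralZl_EFin//; last 2 first.
- by apply/measurable_EFinP; exact: measurable_indic.
- by rewrite divr_ge0// ltW.
rewrite integral_indic// setIT [X in (_ * X)%E]mAE -EFinM lee_fin mulrAC ler_pdivrMr// mul1r /l.
by rewrite -addrA addrCA lerDl addr_ge0.
Qed.

(** Young's inequality for |f|/a and |g|/b, integrated: each modular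
    contributes at most 1, which gives the constant 2. *)
Lemma Lp_norm_hoelder p f g (a b : R) : measurable_fun setT p ->
  (forall x, 1 <= p x)%E -> measurable_cfun f -> measurable_cfun g ->
  (Lp_norm p f < a%:E)%E -> (Lp_norm (fun x => hoelder_conjugate (p x)) g < b%:E)%E ->
  (\int[mu]_x (normc (f x * g x))%:E <= (2 * (a * b))%:E)%E.
Proof.
move=> mp p1 mf mg fa gb.
have p'1 x : (1 <= hoelder_conjugate (p x))%E by exact: hoelder_conj_ge1.
have mp' := measurable_hoelder_conjugate mp p1.
have [a0 fa1] := Lp_norm_lt_modular p1 fa.
have [b0 gb1] := Lp_norm_lt_modular p'1 gb.
have nf := measurable_normc mf; have ng := measurable_normc mg.
have ab0 : 0 < a * b by rewrite mulr_gt0.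

have Lf0 x : 0 <= normc (f x) / a by rewrite divr_ge0 ?normc_ge0 ?ltW.
have Lg0 x : 0 <= normc (g x) / b by rewrite divr_ge0 ?normc_ge0 ?ltW.
have mF : measurable_fun setT (fun x => pow_exponent (normc (f x) / a) (p x)).
  by apply: measurable_pow_exponent => //; exact: measurable_funM.
have mG : measurable_fun setT
    (fun x => pow_exponent (normc (g x) / b) (hoelder_conjugate (p x))).
  by apply: measurable_pow_exponent => //; exact: measurable_funM.
apply: (@le_trans _ _ (\int[mu]_x ((a * b)%:E *
  (pow_exponent (normc (f x) / a) (p x) +
   pow_exponent (normc (g x) / b) (hoelder_conjugate (p x)))))%E).
  apply: ge0_integral_mono => x; first by rewrite lee_fin normc_ge0.
  rewrite (_ : normc (f x * g x) = a * b * (normc (f x) / a * (normc (g x) / b))).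
    by rewrite EFinM lee_pmul2l// pow_exponent_young.
  by rewrite Normc.normcM mulrACA; congr (_ * _); rewrite mulrC divfK// gt_eqF.
rewrite ge0_integralZl_EFin ?(ltW ab0)//; last 2 first.
- by move=> x _; rewrite adde_ge0 ?pow_exponent_ge0.
- exact: emeasurable_funD.
rewrite ge0_integralD//; try by move=> x _; exact: pow_exponent_ge0.
rewrite [2 * _]mulrC [(_ * 2)%:E]EFinM lee_pmul2l//.
by rewrite -[2]/(1 + 1) EFinD leeD.
Qed.

End variable_exponent_norm.

(** * The local dual norm *)

Section local_dual_norm.
Variables (R : realType) (d : nat).
Local Notation mu := (lebesgue_rV R d).
Local Notation fct := ('rV[R]_d -> complex R).
Local Notation normc := Normc.normc.
Implicit Types (p : 'rV[R]_d -> \bar R) (f g : fct) (u v : 'rV[R]_d -> R).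

(** This rests on (r - 1) r' = r and, since m >= 1 and r' >= 1, on m^(-r') <=
    1/m. For r = 1 the conjugate exponent is +oo and the left-hand side
    vanishes. *)
Lemma pow_exponent_dual (t m r : R) : 0 <= t -> 1 <= m -> 1 <= r ->
  (pow_exponent (t `^ (r - 1) / m) (hoelder_conjugate r%:E) <= (t `^ r / m)%:E)%E.
Proof.
move=> t0 m1; have m0 : 0 < m by rewrite (lt_le_trans ltr01).
rewrite le_eqVlt => /predU1P[<-|r1].
  rewrite hoelder_conjugate1 /= subrr powRr0 div1r invf_le1// m1.
  by rewrite lee_fin divr_ge0 ?powR_ge0// ltW.
rewrite hoelder_conjugate_EFin//= lee_fin powRM ?powR_ge0 ?invr_ge0 ?(ltW m0)//.
rewrite -powRrM [(r - 1) * _]mulrC divfK ?subr_eq0 ?gt_eqF//.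
rewrite ler_wpM2l ?powR_ge0//.
apply: ge1r_powR; first by rewrite invr_gt0 m0 invf_le1.
by rewrite ler_pdivlMr ?subr_gt0// mul1r gerBl.
Qed.

Lemma measurable_powR_exponent p u : measurable_fun setT p ->
  measurable_fun setT u ->
  measurable_fun setT (fun x => u x `^ (fine (p x))).
Proof.
move=> mp meas_u; apply/measurable_EFinP.
apply: (@measurable_pow_exponent _ _ (fun x => (fine (p x))%:E)) => //.
by apply/measurable_EFinP; exact: measurableT_comp.
Qed.

Lemma powR_bounded (t K s P : R) : 0 <= t <= K -> 1 <= K -> 0 <= s <= P ->
  t `^ s <= K `^ P.
Proof.
move=> /andP[t0 tK] K1 /andP[s0 sP]; apply: (@le_trans _ _ (K `^ s)).
  by apply: ge0_ler_powR => //; rewrite nnegrE (le_trans t0).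
exact: ler_powR.
Qed.

(** As lam lies below the norm, the modular of f/lam on A exceeds 1, and by
    monotone convergence so does the modular m of a truncation u of f/lam. The
    function u^(p-1)/m is bounded, has conjugate modular at most 1, and its
    pairing with |f| is at least lam, because |f| >= lam u on A. *)
Lemma Lp_norm_dual_witness p f (A : set 'rV[R]_d) (P lam : R) :
  measurable_fun setT p -> (forall x, 1 <= p x)%E ->
  {ae mu, forall x, (p x <= P%:E)%E} ->
  measurable A -> (mu A < +oo)%E -> measurable_cfun f ->
  0 < lam -> (lam%:E < Lp_norm p (cutoff A f))%E ->
  exists h : 'rV[R]_d -> R, [/\ measurable_fun setT h, forall x, 0 <= h x,
    exists2 B, 0 <= B & forall x, h x <= B * \1_A x,
    (modular (fun x => hoelder_conjugate (p x)) h <= 1)%E &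
    (lam%:E <= \int[mu]_x (normc (f x) * h x)%:E)%E].
Proof.
move=> mp p1 pP mA Afin mf lam0 lamf.
(* D has full measure in A, and p is real and bounded on D *)
pose D := A `&` [set x | (p x <= P%:E)%E].
have mD : measurable D.
  apply: measurableI => //.
  rewrite (_ : mkset _ = setT `&` p @^-1` `]-oo, P%:E]); last first.
    by rewrite setTI; apply/seteqP; split => x /=; rewrite in_itv.
  by apply: mp => //; exact: emeasurable_itv.
have pD x : D x -> exists2 r, p x = r%:E & 1 <= r <= P.
  move=> [_ /=]; case: (p x) (p1 x) => [r| |] //=.
  by rewrite !lee_fin => ? ?; exists r => //; apply/andP.
have mnf := measurable_normc mf.
pose u (n : nat) x : R := Num.min (normc (f x)) n%:R / lam.
have mu_ n : measurable_fun setT (u n).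
  by apply: measurable_funM => //; exact: measurable_minr.
have u0 n x : 0 <= u n x by rewrite divr_ge0 ?(ltW lam0)// le_min normc_ge0/=.
pose phi n x : R := u n x `^ (fine (p x)) * \1_D x.
have mphi n : measurable_fun setT (fun x => (phi n x)%:E).
  apply/measurable_EFinP; apply: measurable_funM; last exact: measurable_indic.
  exact: measurable_powR_exponent.
have phi0 n x : (0 <= (phi n x)%:E)%E by rewrite lee_fin mulr_ge0 ?powR_ge0.
(* the pointwise limit of phi; its integral is the modular of f/lam on A *)
pose psi x : R := (normc (f x) / lam) `^ (fine (p x)) * \1_D x.
have psi1 : (1 < \int[mu]_x (psi x)%:E)%E.
  rewrite ltNge; apply/negP => psi1; move: lamf; apply/negP; rewrite -leNgt.
  apply: ereal_inf_lbound; exists lam => //; split => //.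
  apply: le_trans psi1; rewrite le_eqVlt; apply/orP; left; apply/eqP.
  apply: ae_eq_integral => //.
  - apply: measurable_pow_exponent => //; apply: measurable_funM => //.
    by apply: measurable_normc; exact: measurable_cutoff.
  - apply/measurable_EFinP; apply: measurable_funM; last exact: measurable_indic.
    by apply: measurable_powR_exponent => //; exact: measurable_funM.
  apply: filterS pP => x pxP _; rewrite normc_cutoff /psi.
  have [xA|xA] := boolP (x \in A); last first.
    rewrite !indicE (negbTE xA) [x \in D]memNset ?mulr0 ?mul0r; last first.
      by move=> [xA']; move: xA; rewrite mem_set.
    apply/eqP; rewrite eq_le pow_exponent_ge0 andbT.
    by apply: pow_exponent_le_id; rewrite ?p1// lexx ler01.
  have xD : D x by split => //; exact: set_mem.
  have [r pr _] := pD _ xD.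
  by rewrite !indicE xA mem_set// !mulr1 pr.
have nd_phi x : {homo (fun n => (phi n x)%:E) : n m / (n <= m)%N >-> (n <= m)%E}.
  move=> n m nm; rewrite lee_fin ler_wpM2r//.
  have fp0 : 0 <= fine (p x) by rewrite fine_ge0// (le_trans _ (p1 x)).
  apply: ge0_ler_powR => //; rewrite ?nnegrE// ler_pM2r ?invr_gt0//.
  by rewrite le_min ge_min lexx/= ge_min ler_nat nm orbT.
have cvg_phi x : (phi n x)%:E @[n --> \oo] --> (psi x)%:E.
  apply: cvg_near_cst; exists (Num.truncn (normc (f x))).+1 => // n /= nx.
  rewrite /phi /u min_l// ltW// (lt_le_trans (truncnS_gt _))// ler_nat//.
have [n phin1] : exists n, (1 < \int[mu]_x (phi n x)%:E)%E.
  apply: contrapT => /forallNP phi1; move: psi1; apply/negP; rewrite -leNgt.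
  have cv : (\int[mu]_x (phi n x)%:E)%E @[n --> \oo] --> (\int[mu]_x (psi x)%:E)%E.
    rewrite (_ : (fun x => (psi x)%:E) = fun x => limn (fun n => (phi n x)%:E)).
      by apply: cvg_monotone_convergence => // x _; exact: nd_phi.
    by apply/funext => x; exact/esym/cvg_lim.
  rewrite -(cvg_lim _ cv)//; apply: lime_le; first by apply/cvgP; exact: cv.
  by apply: nearW => n; rewrite leNgt; apply/negP; exact: phi1.
pose K : R := Num.max 1 (n%:R / lam).
have K1 : 1 <= K by rewrite le_max lexx.
have uK x : 0 <= u n x <= K.
  by rewrite u0 le_max ler_pM2r ?invr_gt0// ge_min lexx !orbT.
have KP0 : 0 <= K `^ P by exact: powR_ge0.
have phifin : (\int[mu]_x (phi n x)%:E < +oo)%E.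
  apply: (@le_lt_trans _ _ (\int[mu]_x (K `^ P * \1_A x)%:E)%E).
    apply: ge0_integral_mono => // x; rewrite lee_fin /phi !indicE.
    have [/set_mem xD|_] := boolP (x \in D); last by rewrite mulr0 mulr_ge0.
    have [r -> /andP[r1 rP]] := pD _ xD.
    rewrite mem_set ?mulr1; last by case: xD.
    by apply: powR_bounded => //=; rewrite rP (le_trans ler01).
  under eq_integral do rewrite EFinM.
  rewrite ge0_integralZl_EFin//; last by apply/measurable_EFinP; exact: measurable_indic.
  by rewrite integral_indic// setIT lte_mul_pinfty// lee_fin.
(* finite as the truncation is bounded and p <= P on D *)
pose m := fine (\int[mu]_x (phi n x)%:E)%E.
have mE : (\int[mu]_x (phi n x)%:E)%E = m%:E.
  rewrite fineK// ge0_fin_numE; first exact: phifin.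
  by apply: integral_ge0 => x _; exact: phi0.
have m1 : 1 < m by rewrite -lte_fin -mE.
have m0 : 0 < m by rewrite (lt_trans _ m1).
pose h x : R := u n x `^ (fine (p x) - 1) / m * \1_D x.
have h0 x : 0 <= h x by rewrite mulr_ge0// divr_ge0 ?powR_ge0// ltW.
exists h; split => //.
- apply: measurable_funM; last exact: measurable_indic.
  apply: measurable_funM => //; apply/measurable_EFinP.
  apply: (@measurable_pow_exponent _ _ (fun x => (fine (p x) - 1)%:E)) => //.
  by apply/measurable_EFinP; apply: measurable_funB => //; exact: measurableT_comp.
- exists (K `^ P) => // x; rewrite /h !indicE.
  have [/set_mem xD|_] := boolP (x \in D); last by rewrite mulr0 mulr_ge0.
  have [r -> /andP[r1 rP]] := pD _ xD.
  rewrite mem_set ?mulr1; last by case: xD.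
  rewrite ler_pdivrMr// (@le_trans _ _ (K `^ P))// ?ler_peMr ?(ltW m1)//.
  by apply: powR_bounded; rewrite //= subr_ge0 r1 lerBlDr (le_trans rP)// lerDl.
- apply: (@le_trans _ _ (\int[mu]_x (m^-1%:E * (phi n x)%:E))%E).
    apply: ge0_integral_mono => x; first exact: pow_exponent_ge0.
    rewrite /h /phi indicE.
    have [/set_mem xD|_] := boolP (x \in D); last first.
      rewrite !mulr0 mule0; apply: pow_exponent_le_id; last by rewrite lexx ler01.
      exact: hoelder_conj_ge1.
    have [r -> /andP[r1 rP]] := pD _ xD.
    by rewrite !mulr1 -EFinM [m^-1 * _]mulrC; apply: pow_exponent_dual => //; exact: ltW.
  rewrite ge0_integralZl_EFin// ?invr_ge0 ?(ltW m0)//.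
  by rewrite mE -EFinM mulVf ?gt_eqF.
- apply: (@le_trans _ _ (\int[mu]_x ((lam / m)%:E * (phi n x)%:E))%E).
    rewrite ge0_integralZl_EFin// ?divr_ge0 ?(ltW m0) ?(ltW lam0)//.
    by rewrite mE -EFinM divfK ?gt_eqF.
  apply: ge0_integral_mono => x.
    by rewrite mule_ge0// lee_fin divr_ge0 ?(ltW m0) ?(ltW lam0).
  rewrite -EFinM lee_fin /h /phi indicE.
  have [/set_mem xD|_] := boolP (x \in D); last by rewrite !mulr0.
  have [r -> /andP[r1 rP]] := pD _ xD; rewrite !mulr1/=.
  rewrite mulrA mulrAC ler_pM2r ?invr_gt0// -mulr_powRB1//; last first.
    by rewrite (lt_le_trans ltr01).
  rewrite mulrA ler_wpM2r ?powR_ge0// /u mulrC divfK ?gt_eqF//.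
  by rewrite ge_min lexx.
Qed.

End local_dual_norm.

(** * The l^q norm and the decomposition into unit cubes *)

Section lq_norm_by_finite_sums.
Variables (R : realType) (d : nat).
Implicit Types (N : 'rV[int]_d -> \bar R) (r : seq 'rV[int]_d).

Lemma poweR_inv_le (X : \bar R) (s A : R) : (0 <= X)%E -> 0 < s -> 0 <= A ->
  (X `^ s^-1 <= A%:E)%E = (X <= (A `^ s)%:E)%E.
Proof.
move=> X0 s0 A0; case: X X0 => [x| |] //= x0; last first.
  by rewrite gt_eqF ?invr_gt0// !leNgt !ltry.
rewrite !lee_fin; rewrite lee_fin in x0.
have -> : x = (x `^ s^-1) `^ s by rewrite -powRrM mulVf ?gt_eqF// powRr1.
rewrite -[in LHS]powRrM mulfV ?gt_eqF// powRr1 ?powR_ge0//.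
apply/idP/idP => [xA|]; first by apply: ge0_ler_powR; rewrite ?nnegrE ?powR_ge0// ltW.
apply: contraTT; rewrite -!ltNge => Ax.
by apply: gt0_ltr_powR; rewrite ?nnegrE ?powR_ge0.
Qed.

Lemma sum_le_esum N r : uniq r -> (forall k, 0 <= N k)%E ->
  (\sum_(k <- r) N k <= \esum_(k in setT) N k)%E.
Proof.
move=> ur N0; rewrite fsbig_seq//; apply: ereal_sup_ubound; exists [set` r] => //.
by split => //; exact: finite_seq.
Qed.

(** Replaces the unordered sum in the l^s norm by finite sums of real numbers. *)
Lemma lq_norm_leP N (s A : R) : 0 < s -> 0 <= A -> (forall k, 0 <= N k)%E ->
  (lq_norm s%:E N <= A%:E)%E <->
  (forall k, N k <= A%:E)%E /\
  (forall r, uniq r -> \sum_(k <- r) fine (N k) `^ s <= A `^ s).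
Proof.
move=> s0 A0 N0; have N0s k : (0 <= N k `^ s)%E by exact: poweR_ge0.
have sumE r : (forall k, N k < +oo)%E ->
    (\sum_(k <- r) N k `^ s = (\sum_(k <- r) fine (N k) `^ s)%:E)%E.
  move=> Nfin; rewrite -sumEFin; apply: eq_bigr => k _.
  by rewrite -{1}[N k]fineK ?ge0_fin_numE.
rewrite /= poweR_inv_le//; last exact: esum_ge0.
split=> [NA|[NA sA]].
  have NkA k : (N k <= A%:E)%E.
    have : (N k `^ s <= (A `^ s)%:E)%E.
      by apply: le_trans NA; have := @sum_le_esum _ [:: k] isT N0s; rewrite big_seq1.
    by rewrite -poweR_inv_le ?poweR_ge0// -poweRrM mulfV ?gt_eqF// poweRe1.
  split=> // r ur; rewrite -lee_fin -sumE; last first.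
    by move=> k; rewrite (le_lt_trans (NkA k)) ?ltry.
  by apply: le_trans NA; exact: sum_le_esum.
apply: ge_ereal_sup => _ [X [finX _] <-].
rewrite fsbig_finite//= sumE; last first.
  by move=> k; rewrite (le_lt_trans (NA k)) ?ltry.
rewrite lee_fin sA//; exact: finmap.fset_uniq.
Qed.

Lemma sum_uniq_subset (F : 'rV[int]_d -> R) r r' : uniq r -> uniq r' ->
  (forall k, 0 <= F k) -> (forall k, k \notin r' -> F k = 0) ->
  \sum_(k <- r) F k <= \sum_(k <- r') F k.
Proof.
move=> ur ur' F0 Fr'; rewrite (bigID (mem r')) /= [X in _ + X]big1; last first.
  by move=> k; exact: Fr'.
rewrite addr0 [leRHS](bigID (mem r)) /= -[leLHS]addr0 lerD//; last exact: sumr_ge0.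
rewrite -big_filter -[leRHS]big_filter (perm_big [seq k <- r' | k \in r]) //.
by apply: uniq_perm; rewrite ?filter_uniq// => k; rewrite !mem_filter andbC.
Qed.

End lq_norm_by_finite_sums.

Section cubes.
Variables (R : realType) (d : nat).
Local Notation mu := (lebesgue_rV R d).

Lemma measurable_cube (r : R) (k : 'rV[int]_d) : measurable (cube r k).
Proof.
rewrite (_ : cube r k = [set x : 'rV[R]_d | forall j,
  `[r * (k ord0 j)%:~R, r * (k ord0 j + 1)%:~R[%classic (x ord0 j)]).
  exact: (measurable_rV_forall (fun=> measurable_itv _)).
by apply/seteqP; split => x /= xk j; have := xk j; rewrite in_itv.
Qed.

Lemma cube_floor (x : 'rV[R]_d) : cube 1 (\row_j Num.floor (x ord0 j)) x.
Proof. by move=> j; rewrite !mul1r mxE floor_itv. Qed.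

(** The index of the unit cube containing x is the vector of integer parts of
    x. *)
Lemma cube_inj (k l : 'rV[int]_d) (x : 'rV[R]_d) : cube 1 k x -> cube 1 l x -> k = l.
Proof.
move=> xk xl; apply/rowP => j.
have := xk j; rewrite !mul1r => /floor_def <-.
by have := xl j; rewrite !mul1r => /floor_def <-.
Qed.

Lemma cube_sub_box (k : 'rV[int]_d) :
  exists N : nat, cube 1 k `<=` rV_box (- N%:R : R) N%:R.
Proof.
exists (\max_(j < d) `|k ord0 j|)%N.+1 => x xk j.
have kN : (`|k ord0 j| <= \max_(j < d) `|k ord0 j|)%N.
  by rewrite (bigD1 j)//= leq_maxl.
have := xk j; rewrite !mul1r => /andP[kx xk1].
set N := (\max_(_ < _) _)%N in kN *.
have lo : (- N.+1%:Z)%:~R <= (k ord0 j)%:~R :> R by rewrite ler_int; lia.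
have hi : (k ord0 j + 1)%:~R <= (N.+1%:Z)%:~R :> R by rewrite ler_int; lia.
by rewrite !pmulrn -mulrNz (le_trans lo kx) (lt_le_trans xk1 hi).
Qed.

Lemma rV_box_lty (N : R) : 0 <= N -> (mu (rV_box (- N) N) < +oo)%E.
Proof. by move=> N0; rewrite lebesgue_rV_box ?ltry// ge0_cp. Qed.

Lemma cube_lty (k : 'rV[int]_d) : (mu (cube 1 k) < +oo)%E.
Proof.
have [N kN] := cube_sub_box k.
apply: le_lt_trans (@rV_box_lty N%:R _) => //.
by apply: le_measure; rewrite ?inE//; [exact: measurable_cube|exact: measurable_rV_box].
Qed.

Lemma finite_cubes_box (N : nat) : exists2 S : seq 'rV[int]_d, uniq S &
  forall k, (exists2 x, rV_box (- N%:R : R) N%:R x & cube 1 k x) -> k \in S.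
Proof.
pose g (i : 'rV['I_(N.+1 + N.+1)]_d) : 'rV[int]_d := \row_j ((i ord0 j)%:Z - N.+1%:Z).
exists (undup [seq g i | i <- enum {: 'rV['I_(N.+1 + N.+1)]_d}]); first exact: undup_uniq.
move=> k [x xN xk]; rewrite mem_undup; apply/mapP.
have kN j : (`|(k ord0 j + N.+1%:Z)%R| < N.+1 + N.+1)%N /\ 0 <= k ord0 j + N.+1%:Z.
  have /andP[x1 x2] := xN j; have := xk j; rewrite !mul1r => /andP[k1 k2].
  have : (k ord0 j)%:~R < (N%:Z)%:~R :> R by rewrite (le_lt_trans k1).
  have : (- N%:Z)%:~R < (k ord0 j + 1)%:~R :> R by rewrite mulrNz (le_lt_trans x1).
  by rewrite !ltr_int; lia.
exists (\row_j inord `|(k ord0 j + N.+1%:Z)%R|%N); first by rewrite mem_enum.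
apply/rowP => j; rewrite !mxE inordK; last by have [] := kN j.
by have [_ kN0] := kN j; rewrite gez0_abs// addrK.
Qed.

(** The unit cubes partition the space; they are enumerated through the
    countability of their index set. *)
Lemma ge0_integral_le_cubes (F : 'rV[R]_d -> \bar R) (B : \bar R) :
  measurable_fun setT F -> (forall x, 0 <= F x)%E ->
  (forall r : seq 'rV[int]_d, uniq r ->
    \sum_(k <- r) \int[mu]_(x in cube 1%R k) F x <= B)%E ->
  (\int[mu]_x F x <= B)%E.
Proof.
move=> mF F0 FB.
(* [pickle_inv] sends distinct indices to distinct cubes, unlike [unpickle] *)
pose C n : set 'rV[R]_d := if @pickle_inv 'rV[int]_d n is Some k then cube 1 k else set0.
have CT : setT = \bigcup_n C n.
  apply/seteqP; split => // x _.
  exists (pickle (\row_j Num.floor (x ord0 j) : 'rV[int]_d)) => //.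
  by rewrite /C pickleK_inv; exact: cube_floor.
rewrite CT ge0_integral_bigcup//; last 3 first.
- by move=> n; rewrite /C; case: pickle_inv => // k; exact: measurable_cube.
- by rewrite -CT.
- apply/trivIsetP => i j _ _; apply: contraNeq => /set0P[x []]; rewrite /C.
  case Ei: (pickle_inv i) => [k|//]; case Ej: (pickle_inv j) => [l|//] xk xl.
  have := @pickle_invK 'rV[int]_d i; have := @pickle_invK 'rV[int]_d j.
  by rewrite Ei Ej/= (cube_inj xk xl) => <- <-.
apply: lime_le.
  by apply: is_cvg_nneseries => n _ _; exact: integral_ge0.
apply: nearW => n.
rewrite (_ : \sum_(0 <= i < n) _ = (\sum_(0 <= i < n)
    oapp (fun k => \int[mu]_(x in cube 1%R k) F x) 0 (pickle_inv i))%E); last first.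
  by apply: eq_bigr => i _; rewrite /C; case: pickle_inv => //=; rewrite integral_set0.
rewrite -big_pmap; apply: FB.
by apply: (pmap_uniq (@pickle_invK 'rV[int]_d)); exact: iota_uniq.
Qed.

End cubes.

(** * Duality of amalgam norms *)

Section amalgam_duality.
Variables (R : realType) (d : nat).
Local Notation mu := (lebesgue_rV R d).
Local Notation fct := ('rV[R]_d -> complex R).
Local Notation normc := Normc.normc.
Implicit Types (p : 'rV[R]_d -> \bar R) (f g h : fct) (u v : 'rV[R]_d -> R).

(** Young's inequality term by term, after dividing N by A; for q = +oo the
    sequence N is simply bounded by A. *)
Lemma lq_norm_hoelder (q : \bar R) (N M : 'rV[int]_d -> \bar R) (A : R) :
  (1 < q)%E -> 0 < A -> (forall k, 0 <= N k)%E -> (forall k, 0 <= M k)%E ->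
  (lq_norm q N <= A%:E)%E -> (lq_norm (hoelder_conjugate q) M <= 1)%E ->
  [/\ forall k, (N k < +oo)%E, forall k, (M k < +oo)%E &
    forall r : seq 'rV[int]_d, uniq r -> \sum_(k <- r) fine (N k) * fine (M k) <= 2 * A].
Proof.
move=> q1 A0 N0 M0; case: q q1 => [q| |] //= q1.
- rewrite lte_fin in q1; have q0 : 0 < q by rewrite (lt_trans ltr01).
  have q10 : 0 < q - 1 by rewrite subr_gt0.
  have s0 : 0 < q / (q - 1) by rewrite divr_gt0.
  rewrite hoelder_conjugate_EFin//.
  move=> /(lq_norm_leP q0 (ltW A0) N0)[NA sA] /(lq_norm_leP s0 ler01 M0)[M1 s1].
  split=> [k|k|r ur]; [by rewrite (le_lt_trans (NA k)) ?ltry|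
    by rewrite (le_lt_trans (M1 k)) ?ltry|].
  apply: (@le_trans _ _ (\sum_(k <- r) A * ((A `^ q)^-1 * fine (N k) `^ q +
      fine (M k) `^ (q / (q - 1))))).
    apply: ler_sum => k _.
    have N0' : 0 <= fine (N k) by rewrite fine_ge0.
    have M0' : 0 <= fine (M k) by rewrite fine_ge0.
    have NA0 : 0 <= fine (N k) / A by rewrite divr_ge0// ltW.
    have := @pow_exponent_young _ (fine (N k) / A) (fine (M k)) q%:E.
    rewrite lee_fin (ltW q1) => /(_ isT NA0 M0'); rewrite hoelder_conjugate_EFin//= lee_fin.
    have -> : (fine (N k) / A) `^ q = (A `^ q)^-1 * fine (N k) `^ q.
      rewrite powRM ?invr_ge0 ?(ltW A0)// -[in LHS](powR_inv1 (ltW A0)) -powRrM.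
      by rewrite mulN1r powRN mulrC.
    rewrite -(ler_pM2l A0); apply: le_trans.
    by rewrite mulrA [A * _]mulrC divfK ?gt_eqF.
  rewrite -mulr_sumr big_split/= -mulr_sumr mulrC ler_pM2r// -[leRHS]/(1 + 1) lerD//.
    by rewrite ler_pdivrMl ?powR_gt0// mulr1 sA.
  by rewrite (le_trans (s1 _ ur))// powR1.
- move=> NA /(lq_norm_leP ltr01 ler01 M0)[M1 s1].
  have NkA k : (N k <= A%:E)%E by apply: le_trans NA; apply: ereal_sup_ubound; exists k.
  split=> [k|k|r ur]; [by rewrite (le_lt_trans (NkA k)) ?ltry|
    by rewrite (le_lt_trans (M1 k)) ?ltry|].
  apply: (@le_trans _ _ (\sum_(k <- r) A * fine (M k) `^ 1)).
    apply: ler_sum => k _.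
    rewrite powRr1 ?fine_ge0// ler_wpM2r ?fine_ge0// -lee_fin fineK//.
    by rewrite ge0_fin_numE// (le_lt_trans (NkA k)) ?ltry.
  rewrite -mulr_sumr mulrC ler_pM2r// (le_trans (s1 _ ur))// powR1.
  by rewrite ler1n.
Qed.

(** Lets the bounds a, b of [Lp_norm_hoelder] tend to the norms. *)
Lemma Lp_norm_hoelder_le p f g : measurable_fun setT p ->
  (forall x, 1 <= p x)%E -> measurable_cfun f -> measurable_cfun g ->
  (Lp_norm p f < +oo)%E -> (Lp_norm (fun x => hoelder_conjugate (p x)) g < +oo)%E ->
  (\int[mu]_x (normc (f x * g x))%:E <=
   (2 * (fine (Lp_norm p f) * fine (Lp_norm (fun x => hoelder_conjugate (p x)) g)))%:E)%E.
Proof.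
move=> mp p1 mf mg foo goo.
have fE : Lp_norm p f = (fine (Lp_norm p f))%:E by rewrite fineK// ge0_fin_numE// Lp_norm_ge0.
have gE : Lp_norm (fun x => hoelder_conjugate (p x)) g =
    (fine (Lp_norm (fun x => hoelder_conjugate (p x)) g))%:E.
  by rewrite fineK// ge0_fin_numE// Lp_norm_ge0.
set a := fine (Lp_norm p f) in fE *; set b := fine (Lp_norm _ g) in gE *.
have a0 : 0 <= a by rewrite fine_ge0// Lp_norm_ge0.
have b0 : 0 <= b by rewrite fine_ge0// Lp_norm_ge0.
apply/lee_addgt0Pr => e e0.
(* chosen so that 2 (a + t) (b + t) <= 2 a b + t c for t <= 1 *)
pose c : R := 2 * (a + b + 1).
have c0 : 0 < c by rewrite mulr_gt0// ltr_wpDl// addr_ge0.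
pose t : R := Num.min 1 (e / c).
have t0 : 0 < t by rewrite lt_min ltr01 divr_gt0.
have t1 : t <= 1 by rewrite ge_min lexx.
have te : t * c <= e by rewrite -ler_pdivlMr// ge_min lexx orbT.
apply: (@le_trans _ _ (2 * ((a + t) * (b + t)))%:E).
  apply: (Lp_norm_hoelder mp) => //; [rewrite fE|rewrite gE];
    by rewrite lte_fin ltrDl.
rewrite -EFinD lee_fin; move: te; rewrite /c.
have : t * t <= t by rewrite ler_piMl// ltW.
nra.
Qed.

(** Hoelder's inequality on each cube costs a factor 2, and Hoelder's
    inequality for the sequences of local norms another factor 2. *)
Lemma amalgam_hoelder p (q : \bar R) g h (A : R) : measurable_fun setT p ->
  (forall x, 1 <= p x)%E -> (1 < q)%E -> measurable_cfun g -> measurable_cfun h ->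
  0 < A -> (amalgam_norm p q g <= A%:E)%E ->
  (amalgam_norm (fun x => hoelder_conjugate (p x)) (hoelder_conjugate q) h <= 1)%E ->
  (\int[mu]_x (normc (g x * h x))%:E <= (4 * A)%:E)%E.
Proof.
move=> mp p1 q1 mg mh A0 gA h1.
have [] := lq_norm_hoelder q1 A0 _ _ gA h1; try by move=> k; exact: Lp_norm_ge0.
move=> gfin hfin sA.
apply: ge0_integral_le_cubes.
- exact: measurable_normcM.
- by move=> x; rewrite lee_fin normc_ge0.
move=> r ur.
apply: (@le_trans _ _ (\sum_(k <- r) (2 *
   (fine (Lp_norm p (cutoff (cube 1 k) g)) *
    fine (Lp_norm (fun x => hoelder_conjugate (p x)) (cutoff (cube 1 k) h))))%:E)%E).
  apply: lee_sum => k _.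
  apply: le_trans (Lp_norm_hoelder_le mp p1 _ _ (gfin k) (hfin k)); last 2 first.
  - by apply: measurable_cutoff => //; exact: measurable_cube.
  - by apply: measurable_cutoff => //; exact: measurable_cube.
  rewrite integral_mkcond; apply: ge0_integral_mono => x; rewrite patchE.
    by case: ifP => // _; rewrite lee_fin normc_ge0.
  rewrite /cutoff; case: ifP => _ //.
  by rewrite lee_fin normc_ge0.
rewrite sumEFin lee_fin -mulr_sumr.
by have := sA _ ur; lra.
Qed.

(** Domination on each cube bounds the local norms by b, so that the amalgam
    norm of a test function is controlled through its coefficients. *)
Lemma amalgam_norm_le1 p (s : R) (b : 'rV[int]_d -> R)
    (w : 'rV[int]_d -> 'rV[R]_d -> R) f :
  (forall x, 1 <= p x)%E -> 0 < s -> (forall k, 0 <= b k) ->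
  (forall r, uniq r -> \sum_(k <- r) b k `^ s <= 1) ->
  (forall k, modular p (w k) <= 1)%E -> (forall k x, 0 <= w k x) ->
  (forall k x, cube 1 k x -> normc (f x) <= b k * w k x) ->
  (amalgam_norm p s%:E f <= 1)%E.
Proof.
move=> p1 s0 b0 sb w1 w0 fw.
have Lb k : (Lp_norm p (cutoff (cube 1 k) f) <= (b k)%:E)%E.
  apply: (Lp_norm_le_modular p1 (b0 k) (w1 k) (w0 k)) => x.
  rewrite /cutoff; case: ifPn => [/set_mem/fw//|_].
  by rewrite Normc.normc0 mulr_ge0.
have Lfin k : (Lp_norm p (cutoff (cube 1 k) f) \is a fin_num)%E.
  by rewrite ge0_fin_numE ?Lp_norm_ge0// (le_lt_trans (Lb k)) ?ltry.
apply/(lq_norm_leP s0 ler01); first by move=> k; exact: Lp_norm_ge0.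
have bk1 k : b k <= 1.
  have := sb [:: k] isT; rewrite big_seq1 => bs.
  rewrite leNgt; apply/negP => b1; move: bs; apply/negP; rewrite -ltNge.
  by have := gt0_ltr_powR s0 ler01 (b0 k) b1; rewrite powR1.
split=> [k|r ur]; first by rewrite (le_trans (Lb k)) ?lee_fin.
rewrite powR1; apply: le_trans (sb _ ur); apply: ler_sum => k _.
apply: ge0_ler_powR; rewrite ?nnegrE ?fine_ge0 ?Lp_norm_ge0 ?(ltW s0)//.
by rewrite -lee_fin fineK.
Qed.

End amalgam_duality.

(** * Dilations *)

Section dilations.
Variables (R : realType) (d : nat).
Local Notation mu := (lebesgue_rV R d).
Local Notation fct := ('rV[R]_d -> complex R).
Local Notation normc := Normc.normc.
Implicit Types (p : 'rV[R]_d -> \bar R) (f g h : fct) (u v : 'rV[R]_d -> R).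

Lemma measurable_cfunD f g : measurable_cfun f -> measurable_cfun g ->
  measurable_cfun (fun x => f x + g x).
Proof.
move=> [f1 f2] [g1 g2]; split.
  by under eq_fun do rewrite raddfD/=; exact: measurable_funD.
by under eq_fun do rewrite raddfD/=; exact: measurable_funD.
Qed.

Lemma measurable_cfunM f g : measurable_cfun f -> measurable_cfun g ->
  measurable_cfun (fun x => f x * g x).
Proof.
move=> [f1 f2] [g1 g2]; split.
  rewrite (_ : (fun _ => _) = fun x => complex.Re (f x) * complex.Re (g x) -
      complex.Im (f x) * complex.Im (g x)).
    by apply: measurable_funB; exact: measurable_funM.
  by apply/funext => x; case: (f x) (g x) => a b [a' b'].
rewrite (_ : (fun _ => _) = fun x => complex.Re (f x) * complex.Im (g x) +
    complex.Im (f x) * complex.Re (g x)).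
  by apply: measurable_funD; exact: measurable_funM.
by apply/funext => x; case: (f x) (g x) => a b [a' b'].
Qed.

Lemma measurable_cfun_cst (z : complex R) : measurable_cfun ((fun=> z) : fct).
Proof. by split; exact: measurable_cst. Qed.

Lemma measurable_cfun_sum (F : nat -> fct) n : (forall i, measurable_cfun (F i)) ->
  measurable_cfun (fun x => \sum_(0 <= i < n) F i x).
Proof.
move=> mF; elim: n => [|n IH].
  by under eq_fun do rewrite big_nil; exact: measurable_cfun_cst.
by under eq_fun do rewrite big_nat_recr//=; exact: measurable_cfunD.
Qed.

Lemma measurable_dilation (alpha : \bar R) (rho : R) f : measurable_cfun f ->
  measurable_cfun (dilation alpha rho f).
Proof.
move=> [f1 f2]; apply: measurable_cfunM; first exact: measurable_cfun_cst.
by split; [apply: (measurableT_comp f1)|apply: (measurableT_comp f2)];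
  exact: measurable_rV_scale.
Qed.

Lemma normc_dilation (alpha : \bar R) (rho : R) f x :
  normc (dilation alpha rho f x) =
  rho `^ (- (d%:R * fine (alpha^-1)%E)) * normc (f (rho^-1 *: x)).
Proof. by rewrite /dilation Normc.normcM normc_real ger0_norm// powR_ge0. Qed.

Lemma fine_inve_hoelder_conjugate (alpha : \bar R) : (1 < alpha)%E ->
  fine (alpha^-1)%E + fine ((hoelder_conjugate alpha)^-1)%E = 1 :> R.
Proof.
move=> a1; have := @hoelder_conjugate_eq1 R alpha (lt_trans (ltNyr _) a1).
rewrite gt_eqF ?(lt_trans _ a1)// => /(_ isT) a'1.
have a'0 : (1 <= hoelder_conjugate alpha)%E by exact: hoelder_conj_ge1 (ltW a1).
rewrite -fineD ?a'1//.
  rewrite ge0_fin_numE ?inve_ge0 ?(le_trans _ (ltW a1))//.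
  by rewrite ltey inve_eqy gt_eqF// (lt_trans _ a1).
rewrite ge0_fin_numE ?inve_ge0 ?(le_trans _ a'0)//.
by rewrite ltey inve_eqy gt_eqF// (lt_le_trans _ a'0).
Qed.

(** The substitution x = rho y produces the factor rho^d, and d - d/alpha' =
    d/alpha. *)
Lemma dilation_adjoint (alpha : \bar R) (rho : R) f g : (1 < alpha)%E -> 0 < rho ->
  measurable_cfun f -> measurable_cfun g ->
  (\int[mu]_x (normc (g x * dilation (hoelder_conjugate alpha) rho f x))%:E =
   \int[mu]_x (normc (dilation alpha rho^-1 g x * f x))%:E)%E.
Proof.
move=> a1 rho0 mf mg.
pose H y : \bar R := ((rho^-1 ^+ d) * normc (dilation alpha rho^-1 g y * f y))%:E.
have mH : measurable_fun setT H.
  apply/measurable_EFinP; apply: measurable_funM => //; apply/measurable_EFinP.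
  by apply: measurable_normcM => //; exact: measurable_dilation.
have H0 y : (0 <= H y)%E.
  by rewrite lee_fin mulr_ge0 ?normc_ge0// exprn_ge0// invr_ge0 ltW.
have powerE : rho `^ (- (d%:R * fine ((hoelder_conjugate alpha)^-1)%E)) =
    rho^-1 ^+ d * rho^-1 `^ (- (d%:R * fine (alpha^-1)%E)).
  rewrite -powR_mulrn ?invr_ge0 ?(ltW rho0)// -powRD; last first.
    by rewrite invr_eq0 (gt_eqF rho0) implybT.
  rewrite -[in RHS](powR_inv1 (ltW rho0)) -powRrM; congr (_ `^ _).
  have := fine_inve_hoelder_conjugate a1; set s := fine _; set t := fine _ => st.
  have -> : s = 1 - t by rewrite -st addrK.
  ring.
transitivity (\int[mu]_x H (rho^-1 *: x))%E.
  apply: eq_integral => x _; rewrite /H; congr EFin.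
  rewrite (Normc.normcM (g x)) (Normc.normcM (dilation _ _ _ _)).
  rewrite !normc_dilation invrK scalerA divff ?gt_eqF// scale1r.
  rewrite powerE; ring.
rewrite ge0_integral_rV_scale ?invr_gt0// invrK.
rewrite /H; under eq_integral do rewrite EFinM.
rewrite ge0_integralZl_EFin//; last 3 first.
- by move=> x _; rewrite lee_fin normc_ge0.
- by apply: measurable_normcM => //; exact: measurable_dilation.
- by rewrite exprn_ge0// invr_ge0 ltW.
by rewrite muleA -EFinM -exprMn divff ?gt_eqF// expr1n mul1e.
Qed.

End dilations.

(** * The Koethe dual norm is bounded by the Fofana norm *)

Section pairing_bound.
Variables (R : realType) (d : nat).
Local Notation mu := (lebesgue_rV R d).
Local Notation fct := ('rV[R]_d -> complex R).
Local Notation normc := Normc.normc.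
Variables (p : 'rV[R]_d -> \bar R) (q alpha : \bar R).
Hypotheses (mp : measurable_fun setT p) (p1 : forall x, (1 <= p x)%E).
Hypotheses (q1 : (1 < q)%E) (alpha1 : (1 < alpha)%E).
Local Notation p' := (fun x => hoelder_conjugate (p x)).
Local Notation q' := (hoelder_conjugate q).
Local Notation alpha' := (hoelder_conjugate alpha).
Implicit Types (f g h : fct).

Definition rV_cbox (a b : R) : set 'rV[R]_d :=
  [set x | forall j, a <= x ord0 j <= b].

Lemma compact_rV_cbox (a b : R) : compact (rV_cbox a b).
Proof.
rewrite (_ : rV_cbox a b = [set x | forall j, `[a, b]%classic (x ord0 j)]).
  by apply: (@rV_compact _ d (fun=> `[a, b]%classic)) => j; exact: segment_compact.
by apply/seteqP; split => x /= xab j; have := xab j; rewrite in_itv.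
Qed.

Lemma measurable_rV_cbox (a b : R) : measurable (rV_cbox a b).
Proof.
rewrite (_ : rV_cbox a b = [set x | forall j, `[a, b]%classic (x ord0 j)]).
  by apply: (measurable_rV_forall (fun=> measurable_itv _)).
by apply/seteqP; split => x /= xab j; have := xab j; rewrite in_itv.
Qed.

Lemma rV_cbox_cover : \bigcup_n rV_cbox (- n%:R) n%:R = setT.
Proof.
apply/seteqP; split => // x _.
exists (\sum_j (Num.truncn `|x ord0 j|).+1)%N => // j.
rewrite -ler_norml; apply: (@le_trans _ _ (Num.truncn `|x ord0 j|).+1%:R).
  by rewrite ltW// truncnS_gt.
by rewrite ler_nat (bigD1 j)//= leq_addr.
Qed.

Lemma nondecreasing_rV_cbox :
  {homo (fun n : nat => rV_cbox (- n%:R) n%:R) : n m / (n <= m)%N >-> (n <= m)%O}.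
Proof.
move=> n m nm; apply/subsetPset => x xn j; have /andP[xlo xhi] := xn j.
have nm' : n%:R <= m%:R :> R by rewrite ler_nat.
by rewrite (le_trans _ xlo) ?lerN2//= (le_trans xhi).
Qed.

(** Monotone convergence along an exhaustion by compact boxes. *)
Lemma ge0_integral_le_cbox (F : 'rV[R]_d -> \bar R) (B : \bar R) :
  measurable_fun setT F -> (forall x, 0 <= F x)%E ->
  (forall n : nat, \int[mu]_(x in rV_cbox (- n%:R)%R n%:R) F x <= B)%E ->
  (\int[mu]_x F x <= B)%E.
Proof.
move=> mF F0 FB; rewrite -rV_cbox_cover.
have cv := @ge0_nondecreasing_set_cvg_integral _ _ _
  (fun n : nat => rV_cbox (- n%:R)%R n%:R) F mu.
rewrite -(cvg_lim _ (cv _ _ _ _))//.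
- apply: lime_le; last exact: nearW.
  apply: ereal_nondecreasing_is_cvgn.
  apply: ge0_nondecreasing_set_nondecreasing_integral => //.
  + exact: nondecreasing_rV_cbox.
  + by move=> n; exact: measurable_rV_cbox.
  + by move=> n; exact: measurable_funTS.
- exact: nondecreasing_rV_cbox.
- by move=> n; exact: measurable_rV_cbox.
- by move=> n; exact: measurable_funTS.
Qed.

(** The dilation is moved onto g, where the Fofana norm controls it. *)
Lemma fofana_atom_pairing_le g h (rho A : R) : measurable_cfun g -> measurable_cfun h ->
  0 < rho -> 0 < A -> (fofana_norm p q alpha g <= A%:E)%E ->
  (amalgam_norm p' q' h <= 1)%E ->
  (\int[mu]_x (normc (g x * dilation alpha' rho h x))%:E <= (4 * A)%:E)%E.
Proof.
move=> mg mh rho0 A0 gA h1; rewrite dilation_adjoint//.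
apply: (amalgam_hoelder mp p1 q1 _ mh A0 _ h1); first exact: measurable_dilation.
apply: le_trans gA; apply: ereal_sup_ubound; exists rho^-1 => //=.
by rewrite invr_gt0.
Qed.

Lemma normc_sum (n : nat) (F : nat -> complex R) :
  normc (\sum_(0 <= i < n) F i) <= \sum_(0 <= i < n) normc (F i).
Proof.
elim: n => [|n IH]; first by rewrite !big_nil Normc.normc0.
by rewrite !big_nat_recr//= (le_trans (le_normcD _ _))// lerD2r.
Qed.

(** On a compact box K, f is a partial sum of the decomposition plus a
    remainder D. The remainder pairs with g by at most e, as its norm on K
    tends to 0 while that of g is finite; the partial sum is estimated atom by
    atom. The individual terms of the decomposition need not be in L^p'_loc. *)
Lemma h_decomposition_pairing_le g f c rho F (A S : R) :
  Lp_loc p g -> 0 < A -> (fofana_norm p q alpha g <= A%:E)%E ->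
  measurable_cfun f -> h_decomposition p' q' alpha' f c rho F ->
  (\sum_(0 <= n <oo) (normc (c n))%:E <= S%:E)%E ->
  (\int[mu]_x (normc (g x * f x))%:E <= (4 * A * S)%:E)%E.
Proof.
move=> [mg gloc] A0 gA mf [rho0 F1 _ cvf] cS.
have mF n : measurable_cfun (F n) by have [[[]]] := F1 n.
have mSt n : measurable_cfun (fun x => c n * dilation alpha' (rho n) (F n) x).
  apply: measurable_cfunM; first exact: measurable_cfun_cst.
  exact: measurable_dilation.
apply: ge0_integral_le_cbox.
- exact: measurable_normcM.
- by move=> x; rewrite lee_fin normc_ge0.
move=> N; set K := rV_cbox _ _.
have mK : measurable K by exact: measurable_rV_cbox.
have cK : compact K by exact: compact_rV_cbox.
have mgK : measurable_cfun (cutoff K g) by exact: measurable_cutoff.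
have [a a0 ga] : exists2 a : R, 0 < a & (Lp_norm p (cutoff K g) < a%:E)%E.
  exists (fine (Lp_norm p (cutoff K g)) + 1).
    by rewrite ltr_wpDl// fine_ge0// Lp_norm_ge0.
  by rewrite -[ltLHS]fineK ?lte_fin ?ltrDl// ge0_fin_numE ?Lp_norm_ge0// gloc.
apply/lee_addgt0Pr => e e0.
(* so that the remainder contributes at most 2 a b = e *)
pose b : R := e / (2 * a).
have b0 : 0 < b by rewrite divr_gt0// mulr_gt0.
have [n nb] : exists n, (Lp_norm p' (cutoff K (fun x =>
    (f x - \sum_(0 <= i < n) c i * dilation alpha' (rho i) (F i) x)%R)) < b%:E)%E.
  have : nbhs (0%E : \bar R) [set y | (y < b%:E)%E].
    by apply: open_nbhs_nbhs; split; [exact: open_ereal_lt_ereal|rewrite /= lte_fin].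
  by move=> /(cvf K cK)[n _ /(_ n (leqnn n))]; exists n.
set D := (fun x => (f x - \sum_(0 <= i < n) c i * dilation alpha' (rho i) (F i) x)%R) in nb.
have mD : measurable_cfun D.
  rewrite (_ : D = fun x => f x + (-1) *
    (\sum_(0 <= i < n) c i * dilation alpha' (rho i) (F i) x)); last first.
    by apply/funext => x; rewrite mulN1r.
  apply: measurable_cfunD => //; apply: measurable_cfunM.
    exact: measurable_cfun_cst.
  exact: measurable_cfun_sum.
have mDK : measurable_cfun (cutoff K D) by exact: measurable_cutoff.
apply: (@le_trans _ _ (\int[mu]_x ((normc (cutoff K g x * cutoff K D x))%:E +
  \sum_(0 <= i < n) (normc (c i))%:E *
     (normc (g x * dilation alpha' (rho i) (F i) x))%:E))%E).
  rewrite integral_mkcond; apply: ge0_integral_mono => x; rewrite patchE.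
    by case: ifP => // _; rewrite lee_fin normc_ge0.
  under eq_bigr do rewrite -EFinM.
  rewrite sumEFin -EFinD /cutoff.
  have s0 : 0 <= \sum_(0 <= i < n) normc (c i) * normc (g x * dilation alpha' (rho i) (F i) x).
    by apply: sumr_ge0 => i _; rewrite mulr_ge0 ?normc_ge0.
  case: ifP => _; last by rewrite lee_fin addr_ge0 ?normc_ge0.
  rewrite lee_fin.
  have -> : g x * f x = g x * D x +
      \sum_(0 <= i < n) c i * (g x * dilation alpha' (rho i) (F i) x).
    under eq_bigr do rewrite mulrCA.
    by rewrite -mulr_sumr -mulrDr /D subrK.
  apply: le_trans (le_normcD _ _) _; rewrite lerD2l.
  apply: le_trans (normc_sum _ _) _; apply: ler_sum => i _.
  by rewrite Normc.normcM.
have mT i : measurable_fun setT (fun x => ((normc (c i))%:E *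
     (normc (g x * dilation alpha' (rho i) (F i) x))%:E)%E).
  apply: measurable_funeM; apply: measurable_normcM => //.
  exact: measurable_dilation.
have T0 i x : (0 <= (normc (c i))%:E *
     (normc (g x * dilation alpha' (rho i) (F i) x))%:E)%E.
  by rewrite mule_ge0// lee_fin normc_ge0.
rewrite ge0_integralD//; last 4 first.
- by move=> x _; rewrite lee_fin normc_ge0.
- exact: measurable_normcM.
- by move=> x _; exact: sume_ge0.
- exact: emeasurable_sum.
rewrite ge0_integral_sum//.
rewrite addeC; apply: leeD; last first.
  apply: le_trans (Lp_norm_hoelder mp p1 mgK mDK ga nb) _.
  by rewrite lee_fin mulrA [2 * a * b]mulrC divfK// gt_eqF// mulr_gt0.
apply: (@le_trans _ _ (\sum_(0 <= i < n) (normc (c i))%:E * (4 * A)%:E)%E).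
  apply: lee_sum => i _; rewrite ge0_integralZl_EFin ?normc_ge0//; last 2 first.
  - by move=> x _; rewrite lee_fin normc_ge0.
  - by apply: measurable_normcM => //; exact: measurable_dilation.
  apply: lee_wpmul2l; first by rewrite lee_fin normc_ge0.
  by apply: fofana_atom_pairing_le => //; have [] := F1 i.
have cn : \sum_(0 <= i < n) normc (c i) <= S.
  rewrite -lee_fin -sumEFin; apply: le_trans cS; apply: nneseries_lim_ge => k _ _.
  by rewrite lee_fin normc_ge0.
under eq_bigr do rewrite -EFinM.
by rewrite sumEFin lee_fin -mulr_suml mulrC ler_pM2l// mulr_gt0.
Qed.

End pairing_bound.

(** * The Fofana norm is bounded by the Koethe dual norm *)

Section converse_bound.
Variables (R : realType) (d : nat).
Local Notation mu := (lebesgue_rV R d).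
Local Notation fct := ('rV[R]_d -> complex R).
Local Notation normc := Normc.normc.
Variables (p : 'rV[R]_d -> \bar R) (q alpha : \bar R).
Hypotheses (mp : measurable_fun setT p) (p1 : forall x, (1 <= p x)%E).
Hypotheses (q1 : (1 < q)%E) (alpha1 : (1 < alpha)%E).
Local Notation p' := (fun x => hoelder_conjugate (p x)).
Local Notation q' := (hoelder_conjugate q).
Local Notation alpha' := (hoelder_conjugate alpha).
Local Notation H := (H_space p' q' alpha').
Local Notation normH := (H_norm p' q' alpha').
Implicit Types (f g : fct) (u w : 'rV[R]_d -> R).

(** The class of test functions: for nonnegative u, boundedness with bounded
    support. It is stable under dilations, unlike L^p'_loc. *)
Definition box_bounded u := exists2 B : R, 0 <= B &
  exists N : nat, forall x, u x <= B * \1_(rV_box (- N%:R) N%:R) x.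

Lemma conjugate_exponent_ge1 x : (1 <= p' x)%E.
Proof. exact: hoelder_conj_ge1. Qed.

Lemma box_bounded_Lp_loc u : measurable_fun setT u -> (forall x, 0 <= u x) ->
  box_bounded u -> Lp_loc p' (fun x => (u x)%:C%C).
Proof.
move=> meas_u u0 [B B0 [N uB]]; split; first exact: measurable_cfun_real.
move=> K _; apply: (@Lp_norm_bounded_lty _ _ _ _ (rV_box (- N%:R) N%:R) B) => //.
- exact: conjugate_exponent_ge1.
- exact: measurable_rV_box.
- exact: rV_box_lty.
move=> x; rewrite normc_cutoff normc_real ger0_norm//; apply: le_trans (uB x).
by rewrite ler_piMr// indicE lern1 leq_b1.
Qed.

Lemma box_bounded_dilation u (rho c : R) : 0 < rho -> 0 <= c -> box_bounded u ->
  box_bounded (fun x => c * u (rho^-1 *: x)).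
Proof.
move=> rho0 c0 [B B0 [N uB]]; exists (c * B); first by rewrite mulr_ge0.
(* the dilation maps the box of radius N into the one of radius rho N *)
pose M : nat := (Num.truncn (rho * N%:R)).+1.
have NM : rho * N%:R <= M%:R by rewrite ltW// truncnS_gt.
exists M => x; rewrite -mulrA ler_wpM2l//; apply: le_trans (uB _) _.
rewrite ler_wpM2l// !indicE ler_nat.
case: (boolP (_ \in rV_box (- N%:R) _)) => // /set_mem xN.
rewrite mem_set//= => j; have := xN j; rewrite mxE => /andP[].
rewrite ler_pdivlMl// mulrN ltr_pdivrMl// => x1 x2.
by rewrite (le_trans _ x1) ?lerN2// (lt_le_trans x2).
Qed.

(** The decomposition has the single coefficient 1; it repeats the same atom
    with coefficient 0 to be indexed by all natural numbers. *)
Lemma one_atom_decomposition u (rho : R) : measurable_fun setT u ->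
  (forall x, 0 <= u x) -> box_bounded u -> 0 < rho ->
  (amalgam_norm p' q' (fun x => (u x)%:C%C) <= 1)%E ->
  let f := dilation alpha' rho (fun x => (u x)%:C%C) in H f /\ (normH f <= 1)%E.
Proof.
move=> meas_u u0 ub rho0 u1 f.
pose c0 : R := rho `^ (- (d%:R * fine (alpha'^-1)%E)).
have fE : f = fun x => (c0 * u (rho^-1 *: x))%:C%C.
  by apply/funext => x; rewrite /f /dilation -rmorphM.
have cu0 x : 0 <= c0 * u (rho^-1 *: x) by rewrite mulr_ge0// powR_ge0.
have locu := box_bounded_Lp_loc meas_u u0 ub.
have locf : Lp_loc p' f.
  rewrite fE; apply: box_bounded_Lp_loc => //.
    apply: measurable_funM => //; apply: measurableT_comp => //.
    exact: measurable_rV_scale.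
  by apply: box_bounded_dilation => //; exact: powR_ge0.
pose c (n : nat) : complex R := if n is 0%N then 1 else 0.
have sumc (V : nmodType) (v : nat -> V) n : (forall i, v i.+1 = 0) ->
    \sum_(0 <= i < n.+1) v i = v 0%N.
  by move=> v0; rewrite big_nat_recl//= big1 ?addr0// => i _; exact: v0.
have sum1 : (\sum_(0 <= n <oo) (normc (c n))%:E = 1)%E.
  apply: cvg_lim => //; apply: cvg_near_cst; exists 1%N => // -[//|n] _.
  by rewrite sumEFin sumc /c ?Normc.normc1// => i; rewrite Normc.normc0.
have dec : h_decomposition p' q' alpha' f c (fun=> rho) (fun=> fun x => (u x)%:C%C).
  split => //.
  - by move=> _; split => //; split => //; rewrite (le_lt_trans u1) ?ltry.
  - by rewrite sum1 ltry.
  - move=> K _; apply: cvg_near_cst; exists 1%N => // -[//|n] _.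
    apply: Lp_norm0; first exact: conjugate_exponent_ge1.
    move=> x; rewrite /cutoff; case: ifP => // _.
    by rewrite sumc ?mul1r ?subrr// => i; rewrite mul0r.
split; first by split => //; exists c, (fun=> rho), (fun=> fun x => (u x)%:C%C).
apply: ereal_inf_lbound; exists c, (fun=> rho), (fun=> fun x => (u x)%:C%C).
split; last by rewrite sum1.
rewrite (_ : (fun x => _) = f)//; apply/funext => x.
by rewrite fE normc_real ger0_norm.
Qed.

(** The dual norm tests g against the dilation of u, and the dilation is moved
    back onto g. *)
Lemma kothe_test g u (rho : R) (M : \bar R) : measurable_cfun g ->
  (kothe_dual_norm H normH g <= M)%E -> measurable_fun setT u ->
  (forall x, 0 <= u x) -> box_bounded u -> 0 < rho ->
  (amalgam_norm p' q' (fun x => (u x)%:C%C) <= 1)%E ->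
  (\int[mu]_x (normc (dilation alpha rho g x) * u x)%:E <= M)%E.
Proof.
move=> mg gM meas_u u0 ub rho0 u1.
have rhoV0 : 0 < rho^-1 by rewrite invr_gt0.
have [Hf f1] := one_atom_decomposition meas_u u0 ub rhoV0 u1.
apply: le_trans gM; apply: ereal_sup_ubound.
exists (dilation alpha' rho^-1 (fun x => (u x)%:C%C)) => //.
rewrite dilation_adjoint ?invrK//.
by apply: eq_integral => x _; rewrite Normc.normcM normc_real ger0_norm.
Qed.

Variable P : R.
Hypothesis pP : {ae mu, forall x, (p x <= P%:E)%E}.

(** Here G stands for a dilation of a function of dual norm at most M. *)
Section tested.
Variables (G : fct) (M : R).
Hypothesis mG : measurable_cfun G.
Hypothesis GM : forall u, measurable_fun setT u -> (forall x, 0 <= u x) ->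
  box_bounded u -> (amalgam_norm p' q' (fun x => (u x)%:C%C) <= 1)%E ->
  (\int[mu]_x (normc (G x) * u x)%:E <= M%:E)%E.

Lemma hoelder_conjugate_gt1_fin : exists2 s : R, 1 <= s & q' = s%:E.
Proof.
case: q q1 => [r| |] //; last by exists 1.
rewrite lte_fin => r1; exists (r / (r - 1)); last exact: hoelder_conjugate_EFin.
by rewrite ler_pdivlMr ?subr_gt0// mul1r gerBl.
Qed.

(** On each cube of S, take the witness of [Lp_norm_dual_witness] for lam_k,
    and test G against their combination with coefficients b_k, whose local
    norms are at most b_k. *)
Lemma tested_finite_sum (S : seq 'rV[int]_d) (s : R) (b lam : 'rV[int]_d -> R) :
  uniq S -> q' = s%:E -> 0 < s -> (forall k, 0 <= b k) ->
  (forall k, k \notin S -> b k = 0) ->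
  (\sum_(k <- S) b k `^ s <= 1) -> (forall k, 0 <= lam k) ->
  (forall k, 0 < lam k -> ((lam k)%:E < Lp_norm p (cutoff (cube 1 k) G))%E) ->
  \sum_(k <- S) b k * lam k <= M.
Proof.
move=> uS qs s0 b0 bS sb lam0 lamG.
have /choice[w Hw] : forall k, exists w : 'rV[R]_d -> R,
    [/\ measurable_fun setT w, forall x, 0 <= w x,
    exists2 B, 0 <= B & forall x, w x <= B * \1_(cube 1 k) x,
    (modular p' w <= 1)%E &
    ((lam k)%:E <= \int[mu]_x (normc (G x) * w x)%:E)%E].
  move=> k; have := lam0 k; rewrite le_eqVlt => /predU1P[<-|lamk]; last first.
    apply: (Lp_norm_dual_witness mp p1 pP) => //; last exact: lamG.
      exact: measurable_cube.
    exact: cube_lty.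
  exists (fun=> 0); split => //.
  - by exists 0 => // x; rewrite mul0r.
  - apply: (@le_trans _ _ 0%E) => //; rewrite -(integral0 mu setT).
    apply: ge0_integral_mono => x; first exact: pow_exponent_ge0.
    by apply: pow_exponent_le_id; rewrite ?lexx ?ler01//; exact: conjugate_exponent_ge1.
  - by apply: integral_ge0 => x _; rewrite mulr0.
have mw k : measurable_fun setT (w k) by have [] := Hw k.
have w0 k x : 0 <= w k x by have [] := Hw k.
have wsupp k x : ~ cube 1 k x -> w k x = 0.
  have [_ _ [B _ wB] _ _] := Hw k => xk; apply/eqP; rewrite eq_le w0 andbT.
  by apply: le_trans (wB x) _; rewrite indicE memNset// mulr0.
pose h x := \sum_(k <- S) b k * w k x.
have mh : measurable_fun setT h.
  by apply: measurable_sum => k; exact: measurable_funM.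
have h0 x : 0 <= h x by apply: sumr_ge0 => k _; rewrite mulr_ge0.
have hcube k x : cube 1 k x -> h x = b k * w k x.
  move=> xk; have [kS|kS] := boolP (k \in S).
    rewrite /h (bigD1_seq k)//= big1 ?addr0// => l lk.
    by rewrite wsupp ?mulr0// => xl; move: lk; rewrite (cube_inj xl xk) eqxx.
  rewrite bS// mul0r /h big_seq big1// => l lS.
  by rewrite wsupp ?mulr0// => xl; move: kS; rewrite (cube_inj xk xl) lS.
have hb : box_bounded h.
  have /choice[B HB] : forall k, exists B, 0 <= B /\ forall x, w k x <= B * \1_(cube 1 k) x.
    by move=> k; have [_ _ [B B0 wB] _ _] := Hw k; exists B.
  have /choice[N HN] := @cube_sub_box R d.
  exists (\sum_(k <- S) b k * B k).
    by apply: sumr_ge0 => k _; rewrite mulr_ge0//; have [] := HB k.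
  exists (\sum_(k <- S) N k)%N => x; rewrite /h mulr_suml big_seq [leRHS]big_seq.
  apply: ler_sum => k kS; rewrite -mulrA ler_wpM2l//.
  have [Bk0 wB] := HB k; apply: le_trans (wB x) _; rewrite ler_wpM2l// !indicE ler_nat.
  case: (boolP (_ \in cube 1 k)) => // /set_mem xk.
  rewrite mem_set//= => j; have /andP[x1 x2] := HN k x xk j.
  have NN : (N k)%:R <= (\sum_(k <- S) N k)%:R :> R.
    by rewrite ler_nat (bigD1_seq k)//= leq_addr.
  by rewrite (le_trans _ x1) ?lerN2// (lt_le_trans x2).
have h1 : (amalgam_norm p' q' (fun x => (h x)%:C%C) <= 1)%E.
  rewrite qs; apply: (@amalgam_norm_le1 _ _ _ _ b w) => //.
  - exact: conjugate_exponent_ge1.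
  - move=> r ur; apply: le_trans sb; apply: sum_uniq_subset => //.
      by move=> k; exact: powR_ge0.
    by move=> k kS; rewrite bS// powR0// gt_eqF.
  - by move=> k; have [] := Hw k.
  - by move=> k x xk; rewrite normc_real ger0_norm// (hcube k).
rewrite -lee_fin; apply: le_trans (GM mh h0 hb h1).
have mT k : measurable_fun setT (fun x => (normc (G x) * w k x)%:E).
  by apply/measurable_EFinP; apply: measurable_funM => //; exact: measurable_normc.
rewrite (_ : (fun x => _) = fun x =>
    (\sum_(k <- S) (b k)%:E * (normc (G x) * w k x)%:E)%E); last first.
  apply/funext => x; under eq_bigr do rewrite -EFinM.
  rewrite sumEFin mulr_sumr; congr EFin; apply: eq_bigr => k _.
  by rewrite mulrCA.
rewrite ge0_integral_sum//; last 2 first.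
- by move=> k; exact: measurable_funeM.
- by move=> k x _; rewrite -EFinM lee_fin !mulr_ge0 ?normc_ge0.
rewrite -sumEFin; apply: lee_sum => k _.
rewrite ge0_integralZl_EFin//; last by move=> x _; rewrite lee_fin mulr_ge0 ?normc_ge0.
rewrite EFinM; apply: lee_wpmul2l; first by rewrite lee_fin.
by have [] := Hw k.
Qed.

Lemma tested_ge0 : 0 <= M.
Proof.
have [s s1 qs] := hoelder_conjugate_gt1_fin.
have := @tested_finite_sum [::] s (fun=> 0) (fun=> 0) isT qs.
rewrite !big_nil; apply => //; rewrite ?ltxx//.
exact: lt_le_trans s1.
Qed.

Lemma ereal_between (x : R) (y : \bar R) : (x%:E < y)%E ->
  exists2 z : R, x < z & (z%:E < y)%E.
Proof.
case: y => [y| |] //; last by exists (x + 1); rewrite ?ltrDl ?ltry.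
by rewrite lte_fin => xy; exists ((x + y) / 2); rewrite ?lte_fin midf_lt.
Qed.

(** The case of one cube, with coefficient 1. *)
Lemma tested_cube k : (Lp_norm p (cutoff (cube 1 k) G) <= M%:E)%E.
Proof.
rewrite leNgt; apply/negP => /ereal_between[l Ml lG].
have l0 : 0 < l by rewrite (le_lt_trans tested_ge0).
have [s s1 qs] := hoelder_conjugate_gt1_fin.
have s0 : 0 < s by rewrite (lt_le_trans ltr01).
move: Ml; apply/negP; rewrite -leNgt.
pose b (j : 'rV[int]_d) : R := if j == k then 1 else 0.
pose lam (j : 'rV[int]_d) : R := if j == k then l else 0.
have bk : b k = 1 by rewrite /b eqxx.
have lamk : lam k = l by rewrite /lam eqxx.
rewrite -[l]mul1r -bk -lamk -[_ * _](big_seq1 +%R k (fun j => b j * lam j)).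
apply: (@tested_finite_sum [:: k] s b lam isT qs s0).
- by move=> j; rewrite /b; case: ifP.
- by move=> j; rewrite mem_seq1 /b => /negbTE ->.
- by rewrite big_seq1 bk powR1.
- by move=> j; rewrite /lam; case: ifP => // _; exact: ltW.
- move=> j; rewrite /lam; case: eqP => [-> _|_ l_gt0]; first exact: lG.
  by exfalso; rewrite ltxx in l_gt0.
Qed.

(** With a_k the local norms of G and T the sum of their r-th powers over S,
    the coefficients a_k^(r-1) / T^(1/r') are extremal in l^r duality and give
    T^(1/r) <= M. The local norms are first shrunk by a factor t < 1, as
    witnesses exist only strictly below the norm. *)
Lemma tested_amalgam_norm : (amalgam_norm p q G <= M%:E)%E.
Proof.
rewrite /amalgam_norm; set N := (fun k => _).
have N0 k : (0 <= N k)%E by exact: Lp_norm_ge0.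
have Nfin k : N k \is a fin_num.
  by rewrite ge0_fin_numE// (le_lt_trans (tested_cube k)) ?ltry.
case: q q1 hoelder_conjugate_gt1_fin tested_finite_sum => [r| |] // r1 _ tsum; last first.
  by apply: ge_ereal_sup => _ [k _ <-]; exact: tested_cube.
rewrite lte_fin in r1; have r0 : 0 < r by rewrite (lt_trans ltr01).
have r10 : 0 < r - 1 by rewrite subr_gt0.
have s0 : 0 < r / (r - 1) by rewrite divr_gt0.
have M0 := tested_ge0.
apply/(lq_norm_leP r0 M0 N0); split=> [k|S uS]; first exact: tested_cube.
set a := fun k => fine (N k).
have a0 k : 0 <= a k by exact: fine_ge0.
set T := \sum_(k <- S) _.
have T0 : 0 <= T by apply: sumr_ge0 => k _; exact: powR_ge0.
have [->|Tn0] := eqVneq T 0; first exact: powR_ge0.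
have Tp : 0 < T by rewrite lt_def Tn0.
have sumb : \sum_(k <- S) ((if k \in S then a k `^ (r - 1) / T `^ ((r - 1) / r) else 0)
    `^ (r / (r - 1))) <= 1.
  rewrite [leLHS](_ : _ = T / T); first by rewrite divff.
  rewrite [X in _ = X / _](_ : T = \sum_(k <- S) a k `^ r)// mulr_suml big_seq [RHS]big_seq.
  apply: eq_bigr => k kS; rewrite kS.
  rewrite powRM ?powR_ge0 ?invr_ge0 ?powR_ge0// -powRrM; congr (_ * _).
    by congr (_ `^ _); field; rewrite subr_eq0 gt_eqF.
  rewrite -[X in X `^ _](powR_inv1 (powR_ge0 _ _)) -!powRrM.
  rewrite (_ : (r - 1) / r * (-1 * (r / (r - 1))) = -1) ?powR_inv1//.
  by field; rewrite subr_eq0 !gt_eqF.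
have Troot (t : R) : 0 < t < 1 -> t * T `^ r^-1 <= M.
  move=> /andP[t0 t1].
  have := tsum S (r / (r - 1)) (fun k => if k \in S then a k `^ (r - 1) / T `^ ((r - 1) / r) else 0)
    (fun k => t * a k) uS (hoelder_conjugate_EFin r1) s0 _ _ sumb.
  rewrite (_ : \sum_(k <- S) _ = t * T `^ r^-1); last first.
    rewrite (_ : T `^ r^-1 = T / T `^ ((r - 1) / r)); last first.
      rewrite -[X in X / _](powRr1 T0) -powRB ?Tn0 ?implybT//.
      by congr (_ `^ _); field; rewrite gt_eqF.
    rewrite mulrA mulr_sumr mulr_suml big_seq [RHS]big_seq.
    apply: eq_bigr => k kS; rewrite kS -/(a k) -(mulr_powRB1 (a0 k) r0).
    ring.
  apply.
  - by move=> k; case: ifP => // _; rewrite divr_ge0 ?powR_ge0.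
  - by move=> k /negbTE ->.
  - by move=> k; rewrite mulr_ge0// ltW.
  - move=> k; rewrite pmulr_rgt0// => ak0; rewrite -/(N k) -[ltRHS]fineK//.
    by rewrite lte_fin -/(a k) gtr_pMl.
have TM : T `^ r^-1 <= M.
  rewrite leNgt; apply/negP => MT.
  set x := T `^ r^-1 in MT Troot.
  have x0 : 0 < x by rewrite powR_gt0.
  (* this factor sends x to the midpoint of M and x *)
  have := Troot ((M + x) / 2 / x).
  rewrite divfK ?gt_eqF// => /(_ _); rewrite ltr_pdivrMr// mul1r.
  rewrite divr_gt0 ?divr_gt0 ?ltr_wpDl//= ; move=> H; have : (M + x) / 2 < x by lra.
  by move=> /H; lra.
rewrite (_ : T = (T `^ r^-1) `^ r); last by rewrite -powRrM mulVf ?gt_eqF// powRr1.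
by apply: ge0_ler_powR; rewrite ?nnegrE ?powR_ge0// ltW.
Qed.

(** If the norm of G on a box were infinite, a witness w would exist there for
    lam = C M + 1. The box meets at most C cubes, so w/C has amalgam norm at
    most 1, and testing G against it gives C M + 1 <= C M. *)
Lemma tested_box (N : nat) : (Lp_norm p (cutoff (rV_box (- N%:R) N%:R) G) < +oo)%E.
Proof.
rewrite ltey; apply/eqP => Goo.
have [s s1 qs] := hoelder_conjugate_gt1_fin.
have s0 : 0 < s by rewrite (lt_le_trans ltr01).
have [S uS HS] := @finite_cubes_box R d N.
pose C : R := Num.max 1 (size S)%:R.
have C1 : 1 <= C by rewrite le_max lexx.
have C0 : 0 < C by rewrite (lt_le_trans ltr01).
have M0 := tested_ge0.
have l0 : 0 < C * M + 1 by rewrite ltr_wpDl// mulr_ge0// ltW.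
have lG : ((C * M + 1)%:E < Lp_norm p (cutoff (rV_box (- N%:R) N%:R) G))%E.
  by rewrite Goo ltry.
have mB : measurable (rV_box (- N%:R) N%:R : set 'rV[R]_d).
  exact: measurable_rV_box.
have Bfin := @rV_box_lty R d N%:R (ler0n _ _).
have [w [mw w0 [B B0 wB] w1 wG]] :=
  Lp_norm_dual_witness mp p1 pP mB Bfin mG l0 lG.
pose b (k : 'rV[int]_d) : R := if k \in S then C^-1 else 0.
pose h x := C^-1 * w x.
have mh : measurable_fun setT h by exact: measurable_funM.
have h0 x : 0 <= h x by rewrite mulr_ge0// invr_ge0 ltW.
have hb : box_bounded h.
  exists (C^-1 * B); first by rewrite mulr_ge0// invr_ge0 ltW.
  by exists N => x; rewrite -mulrA ler_wpM2l// invr_ge0 ltW.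
have h1 : (amalgam_norm p' q' (fun x => (h x)%:C%C) <= 1)%E.
  rewrite qs; apply: (@amalgam_norm_le1 _ _ _ _ b (fun=> w)) => //.
  - exact: conjugate_exponent_ge1.
  - by move=> k; rewrite /b; case: ifP; rewrite // invr_ge0 ltW.
  - move=> r ur; apply: (@le_trans _ _ (\sum_(k <- S) b k `^ s)).
      apply: sum_uniq_subset => // [k|k kS]; first exact: powR_ge0.
      by rewrite /b (negbTE kS) powR0// gt_eqF.
    apply: (@le_trans _ _ (\sum_(k <- S) C^-1)).
      rewrite big_seq [leRHS]big_seq; apply: ler_sum => k kS; rewrite /b kS.
      by apply: ge1r_powR => //; rewrite invr_gt0 C0 invf_le1.
    rewrite big_const_seq count_predT iter_addr_0 -mulr_natl ler_pdivrMr// mul1r.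
    by rewrite le_max lexx orbT.
  - move=> k x xk; rewrite normc_real ger0_norm// /h /b; case: ifP => // kS.
    rewrite mul0r mulr_ge0_le0 ?invr_ge0 ?(ltW C0)//.
    apply: le_trans (wB x) _; rewrite indicE memNset ?mulr0// => xN.
    by move: kS; rewrite HS//; exists x.
have := GM mh h0 hb h1.
rewrite (_ : (fun x => _) = fun x => (C^-1%:E * (normc (G x) * w x)%:E)%E); last first.
  by apply/funext => x; rewrite -EFinM /h mulrCA.
rewrite ge0_integralZl_EFin//; last 3 first.
- by move=> x _; rewrite lee_fin mulr_ge0 ?normc_ge0.
- by apply/measurable_EFinP; apply: measurable_funM => //; exact: measurable_normc.
- by rewrite invr_ge0 ltW.
move=> CM.
have /le_trans/(_ CM) : (C^-1%:E * (C * M + 1)%:E <= C^-1%:E * \int[mu]_x (normc (G x) * w x)%:E)%E.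
  by apply: lee_wpmul2l => //; rewrite lee_fin invr_ge0 ltW.
rewrite -EFinM lee_fin ler_pdivrMl// => ?.
by have : C * M + 1 <= C * M by []; rewrite gerDl ler10.
Qed.

End tested.

Lemma compact_sub_box (K : set 'rV[R]_d) : compact K ->
  exists N : nat, K `<=` rV_box (- N%:R) N%:R.
Proof.
move=> /compact_bounded[B [_ HB]].
have BB1 : B < B + 1 by rewrite ltrDl.
exists (Num.truncn (B + 1)).+1 => x Kx j.
have xB : `|x ord0 j| <= B + 1.
  apply: le_trans (HB _ BB1 x Kx).
  rewrite [leRHS]/Num.Def.normr /= mx_normrE; apply/bigmax_geP; right => /=.
  by exists (ord0, j).
have NB : B + 1 < (Num.truncn (B + 1)).+1%:R by exact: truncnS_gt.
move: xB; rewrite ler_norml => /andP[x1 x2].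
by rewrite (le_trans _ x1) ?lerN2 ?(ltW NB)//= (le_lt_trans x2).
Qed.

Lemma dilation1 g : dilation alpha 1 g = g.
Proof. by apply/funext => x; rewrite /dilation powR1 invr1 scale1r mul1r. Qed.

(** Every dilation of g is tested by [kothe_test]; the undilated g gives local
    integrability. *)
Lemma fofana_norm_le_kothe g (M : R) : measurable_cfun g ->
  (kothe_dual_norm H normH g <= M%:E)%E ->
  Lp_loc p g /\ (fofana_norm p q alpha g <= M%:E)%E.
Proof.
move=> mg gM.
have test rho : 0 < rho -> forall u, measurable_fun setT u ->
    (forall x, 0 <= u x) -> box_bounded u ->
    (amalgam_norm p' q' (fun x => (u x)%:C%C) <= 1)%E ->
    (\int[mu]_x (normc (dilation alpha rho g x) * u x)%:E <= M%:E)%E.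
  by move=> rho0 u meas_u u0 ub u1; exact: kothe_test.
split; last first.
  apply: ge_ereal_sup => _ [rho /= rho0 <-].
  apply: (tested_amalgam_norm _ (test rho rho0)).
  exact: measurable_dilation.
split => // K /compact_sub_box[N KN].
have test1 := test 1 ltr01; rewrite dilation1 in test1.
apply: le_lt_trans (tested_box mg test1 N).
apply: le_Lp_norm => // x; rewrite !normc_cutoff ler_wpM2l ?normc_ge0//.
rewrite !indicE ler_nat; case: (boolP (x \in K)) => // /set_mem/KN xN.
by rewrite mem_set.
Qed.

End converse_bound.

(** * The duality theorem *)

Section duality_bounds.
Variables (R : realType) (d : nat).
Local Notation mu := (lebesgue_rV R d).
Local Notation fct := ('rV[R]_d -> complex R).

Lemma lebesgue_rV_setT_gt0 : (0 < mu setT)%E.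
Proof.
apply: (@lt_le_trans _ _ (mu (rV_box 0 1))).
  by rewrite lebesgue_rV_box// subr0 expr1n.
by apply: le_measure; rewrite ?inE//; exact: measurable_rV_box.
Qed.

(** The measure is not zero, so some point satisfies both almost everywhere
    bounds on p. *)
Lemma exponent_class_gt1 (p : 'rV[R]_d -> \bar R) (alpha : \bar R) :
  exponent_class p -> {ae mu, forall x, (p x <= alpha)%E} -> (1 < alpha)%E.
Proof.
move=> [_ _ p_gt1 _] palpha.
have ae_proper := ae_properfilter_algebraOfSetsType lebesgue_rV_setT_gt0.
have [x [px xp]] := filter_ex (filterI palpha (ess_inf_le mu p)).
exact: lt_le_trans p_gt1 (le_trans xp px).
Qed.

Lemma exponent_class_ae_bounded (p : 'rV[R]_d -> \bar R) : exponent_class p ->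
  exists P : R, {ae mu, forall x, (p x <= P%:E)%E}.
Proof.
move=> [_ _ _ poo].
have [P pP] : exists P : R, (ess_sup mu p <= P%:E)%E.
  case: (ess_sup mu p) poo => [r| |] // _; first by exists r.
  by exists 0; rewrite leNye.
by exists P; exact/ess_supP.
Qed.

Lemma fofana_norm_ge0 (p : 'rV[R]_d -> \bar R) (q alpha : \bar R) (f : fct) :
  (0 <= fofana_norm p q alpha f)%E.
Proof.
apply: (@le_trans _ _ (amalgam_norm p q (dilation alpha 1 f))); last first.
  by apply: ereal_sup_ubound; exists 1 => //=.
have Nsup (N : 'rV[int]_d -> \bar R) : (forall k, 0 <= N k)%E ->
    (0 <= ereal_sup (range N))%E.
  by move=> N0; apply: (le_trans (N0 0)); apply: ereal_sup_ubound; exists 0.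
rewrite /amalgam_norm; case: q => [q'| |]; first exact: poweR_ge0.
  by apply: Nsup => k; exact: Lp_norm_ge0.
by apply: Nsup => k; exact: Lp_norm_ge0.
Qed.

Lemma lee_real_bounds (x y : \bar R) : (forall M : R, (x <= M%:E)%E -> (y <= M%:E)%E) ->
  (y <= x)%E.
Proof.
case: x => [x| |] xy; [exact: xy|exact: leey|].
case: y xy => [y| |] // xy; last by have := xy 0 (leNye _); rewrite leye_eq.
by have := xy (y - 1) (leNye _); rewrite lee_fin lerBrDr gerDl ler10.
Qed.

(** A function of norm at most 1 has a decomposition of |f| of total weight
    below 2; with the constant 4 for each atom this gives 8. *)
Lemma kothe_norm_le_fofana (p : 'rV[R]_d -> \bar R) (q alpha : \bar R) (g : fct) :
  measurable_fun setT p -> (forall x, 1 <= p x)%E -> (1 < q)%E -> (1 < alpha)%E ->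
  fofana p q alpha g ->
  (kothe_dual_norm (H_space (fun x => hoelder_conjugate (p x)) (hoelder_conjugate q)
     (hoelder_conjugate alpha))
   (H_norm (fun x => hoelder_conjugate (p x)) (hoelder_conjugate q)
     (hoelder_conjugate alpha)) g <= 8%:E * fofana_norm p q alpha g)%E.
Proof.
move=> mp p1 q1 alpha1 [gloc goo].
have := fofana_norm_ge0 p q alpha g.
case E : (fofana_norm p q alpha g) goo => [r| |] // _; rewrite lee_fin => r0.
apply/lee_addgt0Pr => e e0; apply: ge_ereal_sup => _ [f [[[mf _] _] f1] <-].
have one_lt_two : ((1%R)%:E < 2%:E :> \bar R)%E by rewrite lte_fin ltr1n.
have := le_lt_trans f1 one_lt_two; rewrite /H_norm /H_sigma.
move=> /ereal_inf_lt[_ [c [rho [F [dec ->]]]] S2].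
have A0 : 0 < r + e / 8 by rewrite ltr_wpDl// divr_gt0.
have mfn : measurable_cfun (fun x => (Normc.normc (f x))%:C%C).
  by apply: measurable_cfun_real; exact: measurable_normc.
have gA : (fofana_norm p q alpha g <= (r + e / 8)%:E)%E.
  by rewrite E lee_fin lerDl divr_ge0// ltW.
have := h_decomposition_pairing_le mp p1 q1 alpha1 gloc A0 gA mfn dec (ltW S2).
rewrite (_ : (fun x => _) = fun x => (Normc.normc (g x * f x))%:E); last first.
  by apply/funext => x; rewrite !Normc.normcM normc_real ger0_norm// normc_ge0.
move/le_trans; apply; rewrite -EFinM -EFinD lee_fin.
lra.
Qed.

End duality_bounds.

Theorem proposition5p3 (R : realType) (d : nat) (hd : (0 < d)%N)
    (p : 'rV[R]_d -> \bar R) (alpha q : \bar R)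
    (hp : exponent_class p)
    (hpalpha : {ae lebesgue_rV R d, forall x, (p x <= alpha)%E})
    (halphaq : (alpha <= q)%E) :
  let p' := fun x => hoelder_conjugate (p x) in
  let q' := hoelder_conjugate q in
  let alpha' := hoelder_conjugate alpha in
  let H := H_space p' q' alpha' in
  let normH := H_norm p' q' alpha' in
  fofana p q alpha = kothe_dual H normH /\
  exists c C : R, [/\ 0 < c, 0 < C &
    forall g, fofana p q alpha g ->
      (c%:E * fofana_norm p q alpha g <= kothe_dual_norm H normH g)%E /\
      (kothe_dual_norm H normH g <= C%:E * fofana_norm p q alpha g)%E].
Proof.
move=> p' q' alpha' H normH.
have [mp p1 _ _] := hp.
have alpha1 := exponent_class_gt1 hp hpalpha.
have q1 := lt_le_trans alpha1 halphaq.
have [P pP] := exponent_class_ae_bounded hp.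
have upper g : fofana p q alpha g ->
    (kothe_dual_norm H normH g <= 8%:E * fofana_norm p q alpha g)%E.
  exact: kothe_norm_le_fofana.
have lower g M : measurable_cfun g -> (kothe_dual_norm H normH g <= M%:E)%E ->
    Lp_loc p g /\ (fofana_norm p q alpha g <= M%:E)%E.
  exact: (fofana_norm_le_kothe mp p1 q1 alpha1 pP).
split.
  apply/seteqP; split => g.
    move=> fg; have [[mg _] goo] := fg; split=> //.
    by apply: le_lt_trans (upper _ fg) _; apply: lte_mul_pinfty.
  move=> [mg goo]; have [M gM] : exists M : R, (kothe_dual_norm H normH g <= M%:E)%E.
    case: (kothe_dual_norm H normH g) goo => [r| |] // _; first by exists r.
    by exists 0; rewrite leNye.
  have [gloc gM'] := lower g M mg gM; split => //.
  by rewrite (le_lt_trans gM')// ltry.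
exists 1, 8; split => // g fg; split; last exact: upper.
rewrite mul1e; apply: lee_real_bounds => M gM.
by have [[mg _] _] := fg; have [] := lower g M mg gM.
Qed.
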